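(* Let $(g_x)_{x\in\mathcal V_N}$ be a zero mean Gaussian field with $\mathrm{Cov}(g_x,g_y)=(1-\alpha)G(x,y;\alpha)$ for $x,y\in\mathcal V_N$. Then $(g_x)$ has the following strong decomposition as a linear form in independent $N(0,1)$ random variables: there are independent $N(0,1)$ random variables $(g_A)_{A\subseteq[N]}$ such that, for all $x\in\mathcal V_N$, $$g_x=\frac{1}{2^{N/2}}\Big\{g_\emptyset+\sum_{A\subseteq[N],\,A\neq\emptyset}\frac{1}{\sqrt{1+\frac{\alpha}{1-\alpha}(1-\rho_A)}}\cdot\prod_{j\in A}(-1)^{x[j]}\cdot g_A\Big\}.$$ If moreover $Z$ has exchangeable entries (so that $\rho_A$ depends only on $|A|$ and one writes $\rho_{|A|}=\rho_A$), then $$g_x=\frac{1}{2^{N/2}}\Big\{g_\emptyset+\sum_{k=1}^{N}\frac{1}{\sqrt{1+\frac{\alpha}{1-\alpha}(1-\rho_k)}}\cdot S_k\big(x;[N],(g_A)\big)\Big\}.$$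
   Context: $N$ is a positive integer, $[N]=\{1,\dots,N\}$, $\mathcal V_N=\{0,1\}^N$, and $x[k]$ is the $k$-th entry of $x$. $Z$ is a random variable in $\mathcal V_N$ with arbitrary law, and $(Z_t)_{t\ge 0}$ are i.i.d. copies of $Z$. The random walk $(X_t)$ on $\mathcal V_N$ is $X_{t+1}=X_t+Z_t \bmod 2$ (entrywise), $t=0,1,2,\dots$, with $Z_t$ independent of $(X_\tau)_{\tau\le t}$. Write $\mathbb P_t(y\mid x)=\mathbb P(X_t=y\mid X_0=x)$. For a fixed $\alpha\in(0,1)$ the Green function is $G(x,y;\alpha)=\sum_{t=0}^\infty\alpha^t\,\mathbb P_t(y\mid x)$. For $A\subseteq[N]$, $\rho_A=\mathbb E\big[\prod_{j\in A}(-1)^{Z[j]}\big]$, with $\rho_\emptyset=1$. For a finite set $C$ of positive integers and $1\le k\le|C|$, the $k$-spin variable is $$S_k(x;C,(g_A))=\sum_{A\subseteq C,\ |A|=k}\ \prod_{j\in A}(-1)^{x[j]}\,g_A .$$ *)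

(* Defs.v *)
From HB Require Import structures.
From mathcomp Require Import all_boot all_order all_fingroup all_algebra.
From mathcomp Require Import all_classical all_reals all_analysis.

Set Implicit Arguments.
Unset Strict Implicit.
Unset Printing Implicit Defensive.

Import Order.TTheory GRing.Theory Num.Theory.
Import numFieldNormedType.Exports.

Local Open Scope classical_set_scope.
Local Open Scope ring_scope.

(* {0,1}^N.  Coordinates are indexed by 'I_N, i.e. from 0 rather than from 1;
   the sigma-algebra of N.-tuple bool is the full power set. *)
Notation cube N := (N.-tuple bool).

Definition add_mod2 (N : nat) (x z : cube N) : cube N :=
  [tuple tnth x j (+) tnth z j | j < N].

Definition sgn_prod (R : realType) (N : nat) (A : {set 'I_N}) (x : cube N) : R :=
  \prod_(j in A) (-1) ^+ tnth x j.

Section Probability.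
Context (d : measure_display) (T : measurableType d) (R : realType).
Variable P : probability T R.

Definition equal_in_law (d' : measure_display) (U : measurableType d')
    (X Y : T -> U) : Prop :=
  forall B : set U, measurable B -> P (X @^-1` B) = P (Y @^-1` B).

Definition has_law (X : T -> R) (mu : set R -> \bar R) : Prop :=
  forall B : set R, measurable B -> P (X @^-1` B) = mu B.

Definition independent2 (d1 d2 : measure_display) (U1 : measurableType d1)
    (U2 : measurableType d2) (X : T -> U1) (Y : T -> U2) : Prop :=
  forall (A : set U1) (B : set U2), measurable A -> measurable B ->
    P (X @^-1` A `&` Y @^-1` B) = (P (X @^-1` A) * P (Y @^-1` B))%E.

(* Mutual independence: the product rule over every finite subfamily. *)
Definition independent (I : eqType) (d' : measure_display)
    (U : measurableType d') (X : I -> T -> U) : Prop :=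
  forall (s : seq I) (B : I -> set U),
    uniq s -> (forall i, measurable (B i)) ->
    P [set w | forall i, i \in s -> B i (X i w)] =
    (\prod_(i <- s) P (X i @^-1` B i))%E.

(* [normal_prob m 0] is not the point mass at m in the library, hence the
   separate degenerate case. *)
Definition gaussian (X : T -> R) : Prop :=
  (exists m s : R, 0 < s /\ has_law X (normal_prob m s)) \/
  (exists m : R, has_law X (\d_m)).

Definition gaussian_field (I : finType) (g : I -> T -> R) : Prop :=
  forall c : I -> R, gaussian (fun w => \sum_(i : I) c i * g i w).

End Probability.

Section RandomWalk.
Context (d : measure_display) (T : measurableType d) (R : realType).
Variables (Q : probability T R) (N : nat).

Record random_walk (Z : {RV Q >-> cube N}) (Zs X : nat -> {RV Q >-> cube N})
    : Prop := RandomWalk {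
  walk_copies : forall t, equal_in_law Q (Zs t) Z;
  walk_iid : independent Q (fun t => Zs t : T -> cube N);
  walk_step : forall t w, X t.+1 w = add_mod2 (X t w) (Zs t w);
  walk_past : forall t, independent2 Q (Zs t)
    (fun w => [tuple X (i : nat) w | i < t.+1])
}.

(* The elementary conditional probability P(X_t = y | X_0 = x), meaningful when
   P(X_0 = x) > 0. *)
Definition transition (X : nat -> {RV Q >-> cube N}) (t : nat)
    (x y : cube N) : R :=
  fine (Q (X t @^-1` [set y] `&` X 0%N @^-1` [set x])) /
  fine (Q (X 0%N @^-1` [set x])).

Definition green (X : nat -> {RV Q >-> cube N}) (alpha : R)
    (x y : cube N) : R :=
  limn (series (fun t => alpha ^+ t * transition X t x y)).

Definition rho (Z : {RV Q >-> cube N}) (A : {set 'I_N}) : R :=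
  fine 'E_Q[(fun w => sgn_prod R A (Z w))].

Definition exchangeable (Z : {RV Q >-> cube N}) : Prop :=
  forall s : 'S_N,
    equal_in_law Q (fun w => [tuple tnth (Z w) (s j) | j < N]) Z.

End RandomWalk.

Definition spin (R : realType) (N : nat) (k : nat) (x : cube N)
    (C : {set 'I_N}) (g : {set 'I_N} -> R) : R :=
  \sum_(A : {set 'I_N} | (A \subset C) && (#|A| == k)) sgn_prod R A x * g A.

(* Main.v *)
Require Import Defs.
From HB Require Import structures.
From mathcomp Require Import all_boot all_order all_fingroup all_algebra.
From mathcomp Require Import all_classical all_reals all_analysis.
From mathcomp Require Import measurable_realfun.
From mathcomp Require Import ring lra.

Set Implicit Arguments.
Unset Strict Implicit.
Unset Printing Implicit Defensive.

Import Order.TTheory GRing.Theory Num.Theory.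
Import numFieldNormedType.Exports.

Local Open Scope classical_set_scope.
Local Open Scope ring_scope.

(**
The walk is a convolution on the group (Z/2)^N, so the characters
chi_A(x) = sgn_prod A x diagonalise it: chi_A is an eigenfunction of the
transition operator with eigenvalue rho_A.  Expanding the transition
probabilities in characters ([transition_fourier]) and summing geometric series
([green_fourier]) gives

  (1 - alpha) G(x, y) =
    2^-N sum_A (1 - alpha) / (1 - alpha rho_A) chi_A(x) chi_A(y),

and (1 - alpha) / (1 - alpha rho_A) is the inverse of
1 + alpha / (1 - alpha) (1 - rho_A).  The covariance matrix of the field thus
has the orthogonal eigenvectors chi_A with explicit positive eigenvalues, and
the natural candidates for the g_A are the normalised coefficients of the
field in this eigenbasis ([fourier_mode]).  Orthogonality of the characters
recovers the field from them pointwise, on the given probability space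
([fourier_mode_synthesis]), and they are uncorrelated with unit variance.  When
the entries of Z are exchangeable, rho_A is invariant under permutations of
the coordinates, so it depends on |A| alone and the sum over A splits by
cardinality.

What remains is that uncorrelated jointly Gaussian variables are independent.
Here joint Gaussianity is a statement about one-dimensional laws of linear
combinations, so a uniqueness theorem of Cramer-Wold type is unavoidable; it is
obtained one coordinate at a time, which keeps every Fourier argument
one-dimensional.

- Characteristic functions are used in the real form E[cos(t L + th)] with an
  arbitrary phase th, which carries the sine and the cosine at once.  For the
  centred normal law with standard deviation s it is
  cos th * exp(- (s t)^2 / 2) ([normal_pdf_charfun]), by the differential
  equation that integration by parts ([stein_normal_pdf]) provides.

- Let W be a bounded random variable with E[W cos(t Y + th)] = 0 for all t and
  th.  A Gaussian density is a mixture of cosines, hence E[W p(Y)] = 0 for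
  every Gaussian density p; mixtures of narrow Gaussian densities approximate
  Lipschitz functions, these approximate indicators of half-lines, and a
  Dynkin argument yields E[W 1_B(Y)] = 0 for all Borel sets B
  ([weight_annihilates_indic]).

- Applied to W minus its mean, this replaces the coordinates of a family by
  indicators one after the other ([mixed_charfun]), and proves the product
  rule ([charfun_independent]).
*)

(** * Integration by parts against a Gaussian density *)

Section LineIntegral.
Context {R : realType}.
Local Notation mu := (@lebesgue_measure R).
Implicit Types (F f : R -> R).

(** By the fundamental theorem of calculus on [-n, n] and dominated
    convergence; this is the only form of integration by parts on the whole
    line that the Gaussian computations need. *)
Lemma integral_total_derivative F f : continuous f ->
  mu.-integrable setT (EFin \o f) ->
  (forall x, is_derive x (1:R) F (f x)) ->
  F n%:R @[n --> \oo] --> (0:R) -> F (- n%:R) @[n --> \oo] --> (0:R) ->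
  \int[mu]_x f x = 0.
Proof.
move=> cf intf dF Fy FNy.
have mf : measurable_fun setT f by exact: continuous_measurable_fun.
pose f_ n : R -> R := f \_ `[- n.+1%:R, n.+1%:R].
have cF : continuous F.
  by move=> x; apply/differentiable_continuous/derivable1_diffP; case: (dF x).
have If n : (\int[mu]_x (f_ n x)%:E = (F n.+1%:R - F (- n.+1%:R))%:E)%E.
  transitivity (\int[mu]_(x in `[(- n.+1%:R)%R, n.+1%:R%R]) (f x)%:E)%E.
    rewrite [RHS]integral_mkcond/=.
    by under [RHS]eq_integral do rewrite restrict_EFin.
  rewrite (@continuous_FTC2 _ f F)//.
  - by rewrite gtrN.
  - exact: continuous_subspaceT.
  - split=> [x _||]; first by case: (dF x).
    + by apply: cvg_at_right_filter; exact: cF.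
    + by apply: cvg_at_left_filter; exact: cF.
  - by move=> x _; rewrite derive1E; exact: derive_val.
have : (\int[mu]_x (f_ n x)%:E)%E @[n --> \oo] --> (\int[mu]_x (f x)%:E)%E.
  apply: (@dominated_cvg _ _ _ mu setT measurableT
    (fun n x => (f_ n x)%:E) (EFin \o f) (fun x => `|(f x)%:E|%E)) => //.
  - move=> n; apply/measurable_EFinP.
    rewrite /f_; apply/measurable_restrict => //; rewrite setTI.
    exact: measurable_funTS.
  - move=> x _; apply: cvg_near_cst.
    near=> n; rewrite /f_ patchE mem_set//= in_itv/= -ler_norml.
    have : `|x| <= n%:R by near: n; exact: nbhs_infty_ger.
    by move=> /le_trans; apply; rewrite ler_nat.
  - by move/integrable_abse : intf.
  - move=> n x _; rewrite /f_ patchE; case: ifPn => _ //=.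
    by rewrite normr0 lee_fin.
under eq_fun do rewrite If.
have : (F n.+1%:R - F (- n.+1%:R))%:E @[n --> \oo] --> (0:R)%:E.
  apply: cvg_EFin; first exact: nearW.
  rewrite -[X in _ --> X](subr0 0); apply: cvgB.
    by rewrite (cvg_shiftS (fun n => F n%:R)).
  by rewrite (cvg_shiftS (fun n => F (- n%:R))).
move=> c0 c1; have := cvg_unique _ c1 c0.
by rewrite /Rintegral => ->.
Unshelve. all: by end_near. Qed.

End LineIntegral.

Section GaussianDensity.
Context {R : realType}.
Local Notation mu := (@lebesgue_measure R).
Variables (m s : R).
Hypothesis s0 : s != 0.
Local Notation p := (normal_pdf m s).

Lemma is_derive_normal_pdf x :
  is_derive x (1:R) p (- ((x - m) / s ^+ 2) * p x).
Proof.
rewrite normal_pdfE// /normal_fun -mulr_natr.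
apply: is_derive_eq.
by rewrite /GRing.scale/=; field.
Qed.

(** Since 1 + u <= exp u, half of the exponent absorbs a quadratic factor; what
    is left is a Gaussian density whose standard deviation is larger by a
    factor of sqrt 2. *)
Lemma normal_pdf_quadratic_ub : exists2 K : R, 0 < K &
  forall x, (1 + (x - m) ^+ 2) * p x <= K * normal_pdf m (Num.sqrt 2 * s) x.
Proof.
have s'0 : Num.sqrt 2 * s != 0 by rewrite mulf_neq0// sqrtr_eq0 -ltNge.
exists ((1 + 4 * s ^+ 2) * normal_peak s / normal_peak (Num.sqrt 2 * s)).
  apply: divr_gt0; last exact: normal_peak_gt0.
  apply: mulr_gt0; last exact: normal_peak_gt0.
  by rewrite ltr_pwDl// mulr_ge0// sqr_ge0.
move=> x; rewrite !normal_pdfE//=.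
have pk' : normal_peak (Num.sqrt 2 * s) != 0 :> R.
  by rewrite gt_eqF// normal_peak_gt0.
rewrite !mulrA divfK// -!mulrA (mulrCA _ (normal_peak s)).
rewrite [leRHS](mulrCA _ (normal_peak s)).
rewrite ler_pM2l ?normal_peak_gt0//.
pose u := (x - m) ^+ 2 / (4 * s ^+ 2).
have u0 : 0 <= u by rewrite divr_ge0 ?sqr_ge0// mulr_ge0 ?sqr_ge0.
have -> : normal_fun m (Num.sqrt 2 * s) x = expR (- u).
  rewrite /normal_fun exprMn sqr_sqrtr// -mulr_natr /u; congr expR; field.
  by [].
have -> : normal_fun m s x = expR (- u) * expR (- u).
  rewrite /normal_fun -expRD -mulr_natr /u; congr expR; field.
  by [].
rewrite -expr2 [leLHS]mulrA ler_pM2r ?expR_gt0//.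
rewrite expRN ler_pdivrMr ?expR_gt0//.
have -> : (x - m) ^+ 2 = 4 * s ^+ 2 * u.
  by rewrite /u mulrC divfK// mulf_neq0// sqrf_eq0.
have := expR_ge1Dx u; move: (expR u) => e eu.
have s20 : 0 <= 4 * s ^+ 2 by rewrite mulr_ge0// sqr_ge0.
nra.
Qed.

Lemma normal_pdf_quadratic_bounded : exists2 M : R, 0 < M &
  forall x, (1 + (x - m) ^+ 2) * p x <= M.
Proof.
have [K K0 Kp] := normal_pdf_quadratic_ub.
have s'0 : Num.sqrt 2 * s != 0 by rewrite mulf_neq0// sqrtr_eq0 -ltNge.
exists (K * normal_peak (Num.sqrt 2 * s)).
  by rewrite mulr_gt0// normal_peak_gt0.
by move=> x; apply: le_trans (Kp x) _; rewrite ler_pM2l// normal_pdf_ub.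
Qed.

Lemma integrable_quadratic_normal_pdf (g : R -> R) (C : R) :
  measurable_fun setT g -> (forall x, `|g x| <= C * (1 + (x - m) ^+ 2)) ->
  mu.-integrable setT (fun x => (g x * p x)%:E).
Proof.
move=> mg gC; have [K K0 Kp] := normal_pdf_quadratic_ub.
have C0 : 0 <= C.
  by have := le_trans (normr_ge0 _) (gC m); rewrite subrr expr0n addr0 mulr1.
apply: (@le_integrable _ _ R mu setT measurableT _
  (fun x => ((C * K)%:E * (normal_pdf m (Num.sqrt 2 * s) x)%:E)%E)).
- by apply/measurable_EFinP/measurable_funM => //; exact: measurable_normal_pdf.
- move=> x _; rewrite /= lee_fin normrM (ger0_norm (normal_pdf_ge0 _ _ _)).
  apply: le_trans (ler_norm _).
  apply: (@le_trans _ _ (C * (1 + (x - m) ^+ 2) * p x)).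
    by rewrite ler_wpM2r ?normal_pdf_ge0.
  by rewrite -!mulrA ler_wpM2l.
- by apply: integrableZl => //; exact: integrable_normal_pdf.
Qed.

End GaussianDensity.

Section Stein.
Context {R : realType}.
Local Notation mu := (@lebesgue_measure R).
Variables (m s : R).
Hypothesis s0 : s != 0.
Local Notation p := (normal_pdf m s).

(** Stein's identity E[g'(X)] = E[(X - m) / s^2 g(X)] for a normal X: the
    difference of the two integrands is the derivative of g times the density.
    The growth bounds make both sides integrable and the boundary terms
    vanish. *)
Lemma stein_normal_pdf (g g' : R -> R) (C : R) :
  continuous g' -> (forall x, is_derive x (1:R) g (g' x)) ->
  (forall x, `|g x| <= C * (1 + `|x - m|)) ->
  (forall x, `|g' x| <= C * (1 + (x - m) ^+ 2)) ->
  \int[mu]_x (g' x * p x) = \int[mu]_x ((x - m) / s ^+ 2 * g x * p x).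
Proof.
move=> cg' dg gC g'C.
have C0 : 0 <= C.
  by have := le_trans (normr_ge0 _) (gC m); rewrite subrr normr0 addr0 mulr1.
have cg : continuous g.
  by move=> x; apply/differentiable_continuous/derivable1_diffP; case: (dg x).
have cp : continuous p by exact: continuous_normal_pdf.
have cl : continuous (fun x : R => (x - m) / s ^+ 2).
  move=> x; apply: cvgM; last exact: cvg_cst.
  by apply: cvgB; [exact: cvg_id|exact: cvg_cst].
have ch : continuous (fun x => (x - m) / s ^+ 2 * g x).
  by move=> x; apply: cvgM; [exact: cl|exact: cg].
have i1 : mu.-integrable setT (fun x => (g' x * p x)%:E).
  apply: (integrable_quadratic_normal_pdf s0 _ g'C).
  exact: continuous_measurable_fun.
have i2 : mu.-integrable setT (fun x => ((x - m) / s ^+ 2 * g x * p x)%:E).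
  apply: (@integrable_quadratic_normal_pdf _ m s s0 _ (C / s ^+ 2 * 2)).
    exact: continuous_measurable_fun.
  move=> x; rewrite normrM normrM normfV (ger0_norm (sqr_ge0 s)).
  rewrite -(real_normK (num_real (x - m))).
  have := gC x; move: (g x) `|x - m| (normr_ge0 (x - m)) => u v v0 uC.
  have s2 : 0 < (s ^+ 2)^-1 by rewrite invr_gt0 exprn_even_gt0.
  rewrite [C / _]mulrC (mulrC v) -!mulrA ler_pM2l//.
  apply: (@le_trans _ _ (v * (C * (1 + v)))); first by rewrite ler_wpM2l.
  by rewrite mulrCA ler_wpM2l//; nra.
have [M M0 pM] := normal_pdf_quadratic_bounded m s0.
(* (1 + v^2) p is bounded, so (1 + v) p is O(1 / (1 + v)) with v = |u n - m|. *)
have vanish (u : nat -> R) : (forall n, n%:R <= `|u n|) ->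
    g (u n) * p (u n) @[n --> \oo] --> (0:R).
  move=> un; apply/cvgr0Pnorm_le => e e0; near=> n.
  have en : 2 * C * M / e + `|m| <= n%:R by near: n; exact: nbhs_infty_ger.
  have dn : 2 * C * M / e <= `|u n - m|.
    by have := ler_normD (u n - m) m; rewrite subrK; have := un n; lra.
  rewrite normrM (ger0_norm (normal_pdf_ge0 _ _ _)).
  have := pM (u n); have := gC (u n); have := normal_pdf_ge0 m s (u n).
  rewrite -(real_normK (num_real (u n - m))).
  move: (p (u n)) `|g (u n)| `|u n - m| dn (normr_ge0 (u n - m)).
  move=> P G v dv v0 P0 GC PM.
  move: dv; rewrite ler_pdivrMr// => dv.
  have h1 : G * P <= C * (1 + v) * P by rewrite ler_wpM2r.
  have h2 : (1 + v) * (C * (1 + v) * P) <= 2 * C * M.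
    have -> : (1 + v) * (C * (1 + v) * P) = C * ((1 + v) ^+ 2 * P) by ring.
    have : (1 + v) ^+ 2 * P <= 2 * ((1 + v ^+ 2) * P).
      by rewrite mulrA ler_wpM2r//; have := sqr_ge0 (1 - v); nra.
    nra.
  apply: le_trans h1 _.
  have v1 : 0 < 1 + v by lra.
  rewrite -(ler_pM2l v1); apply: le_trans h2 _; nra.
apply/eqP; rewrite -subr_eq0 -RintegralB//; apply/eqP.
apply: (@integral_total_derivative _ (fun x => g x * p x)).
- move=> x; apply: cvgB; apply: cvgM; [exact: cg'|exact: cp|exact: ch|exact: cp].
- by rewrite /comp; under eq_fun do rewrite EFinB; exact: integrableB.
- move=> x; have dp := is_derive_normal_pdf m s0 x; have dgx := dg x.
  apply: is_derive_eq; rewrite /GRing.scale/=; ring.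
- by apply: vanish => n; rewrite ger0_norm.
- by apply: vanish => n; rewrite normrN ger0_norm.
Unshelve. all: by end_near. Qed.

End Stein.

Section Moments.
Context {R : realType}.
Local Notation mu := (@lebesgue_measure R).
Implicit Types (m s t th : R).

Lemma Rintegral_normal_pdf m s : \int[mu]_x normal_pdf m s x = 1.
Proof. by rewrite /Rintegral integral_normal_pdf. Qed.

(** Stein's identity for g = 1. *)
Lemma normal_pdf_centered m s : s != 0 ->
  \int[mu]_x ((x - m) * normal_pdf m s x) = 0.
Proof.
move=> s0.
have := @stein_normal_pdf _ m s s0 (cst 1) (cst 0) 1 _ _ _ _.
have ip : mu.-integrable setT (fun x => ((x - m) * normal_pdf m s x)%:E).
  apply: (@integrable_quadratic_normal_pdf _ m s s0 _ 1).
    by apply: measurable_funB.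
  move=> x; rewrite mul1r -(real_normK (num_real (x - m))).
  by have := sqr_ge0 (1 - `|x - m|); have := normr_ge0 (x - m); nra.
move=> /(_ _ _ _ _)/wrap[].
- by move=> x; exact: cvg_cst.
- by move=> x; rewrite /cst normr1 mul1r lerDl.
- by move=> x; rewrite /cst normr0 mul1r addr_ge0// sqr_ge0.
rewrite /cst; under eq_Rintegral do rewrite mul0r.
rewrite Rintegral_cst// mul0r.
have -> : \int[mu]_x ((x - m) / s ^+ 2 * 1 * normal_pdf m s x) =
          \int[mu]_x ((s ^+ 2)^-1 * ((x - m) * normal_pdf m s x)).
  by apply: eq_Rintegral => x _; rewrite mulr1 mulrAC mulrC mulrA.
rewrite RintegralZl// => /esym/eqP; rewrite mulf_eq0 invr_eq0 sqrf_eq0 (negbTE s0).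
by move/eqP.
Qed.

(** Stein's identity for g(x) = x - m. *)
Lemma normal_pdf_variance m s : s != 0 ->
  \int[mu]_x ((x - m) ^+ 2 * normal_pdf m s x) = s ^+ 2.
Proof.
move=> s0.
have ip : mu.-integrable setT (fun x => ((x - m) ^+ 2 * normal_pdf m s x)%:E).
  apply: (@integrable_quadratic_normal_pdf _ m s s0 _ 1).
    by apply: measurable_funX; apply: measurable_funB.
  by move=> x; rewrite mul1r ger0_norm ?sqr_ge0// lerDr.
have dx x : is_derive x (1:R) (fun x => x - m) 1.
  by apply: is_derive_eq; rewrite subr0.
have := @stein_normal_pdf _ m s s0 (fun x => x - m) (cst 1) 1 _ dx _ _.
move=> /(_ _ _ _)/wrap[].
- by move=> x; exact: cvg_cst.
- by move=> x; rewrite mul1r lerDr.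
- by move=> x; rewrite /cst normr1 mul1r lerDl sqr_ge0.
rewrite /cst; under eq_Rintegral do rewrite mul1r.
rewrite Rintegral_normal_pdf.
have -> : \int[mu]_x ((x - m) / s ^+ 2 * (x - m) * normal_pdf m s x) =
          \int[mu]_x ((s ^+ 2)^-1 * ((x - m) ^+ 2 * normal_pdf m s x)).
  by apply: eq_Rintegral => x _; rewrite expr2 mulrAC -!mulrA mulrCA; ring.
rewrite RintegralZl// => h; have s20 : s ^+ 2 != 0 by rewrite sqrf_eq0.
by apply: (mulfI (invr_neq0 s20)); rewrite -h mulVf.
Qed.

Lemma is_derive_cos_affine x t th :
  is_derive x (1:R) (fun x => cos (t * x + th)) (- (t * sin (t * x + th))).
Proof. by apply: is_derive_eq; rewrite /GRing.scale/=; ring. Qed.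

Lemma is_derive_sin_affine x t th :
  is_derive x (1:R) (fun x => sin (t * x + th)) (t * cos (t * x + th)).
Proof. by apply: is_derive_eq; rewrite /GRing.scale/=; ring. Qed.

Lemma measurable_cos_affine t th :
  measurable_fun setT (fun x : R => cos (t * x + th)).
Proof.
apply: continuous_measurable_fun => x.
apply/differentiable_continuous/derivable1_diffP.
by case: (is_derive_cos_affine x t th).
Qed.

Lemma measurable_sin_affine t th :
  measurable_fun setT (fun x : R => sin (t * x + th)).
Proof.
apply: continuous_measurable_fun => x.
apply/differentiable_continuous/derivable1_diffP.
by case: (is_derive_sin_affine x t th).
Qed.

Lemma integrable_cos_normal_pdf s t th : s != 0 ->
  mu.-integrable setT (fun x => (cos (t * x + th) * normal_pdf 0 s x)%:E).
Proof.
move=> s0; apply: (@integrable_quadratic_normal_pdf _ 0 s s0 _ 1).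
  exact: measurable_cos_affine.
by move=> x; rewrite mul1r (le_trans (cos_max _))// lerDl sqr_ge0.
Qed.

Lemma integrable_sin_normal_pdf s t th : s != 0 ->
  mu.-integrable setT (fun x => (x * sin (t * x + th) * normal_pdf 0 s x)%:E).
Proof.
move=> s0; apply: (@integrable_quadratic_normal_pdf _ 0 s s0 _ 1).
  by apply: measurable_funM => //; exact: measurable_sin_affine.
move=> x; rewrite mul1r normrM subr0 -(real_normK (num_real x)).
have := sin_max (t * x + th); have := normr_ge0 x.
have := normr_ge0 (sin (t * x + th)).
by move: `|x| `|sin _| => u v; have := sqr_ge0 (1 - u); nra.
Qed.

Lemma stein_sin_normal_pdf s t th : s != 0 ->
  \int[mu]_x (x * sin (t * x + th) * normal_pdf 0 s x) =
  s ^+ 2 * t * \int[mu]_x (cos (t * x + th) * normal_pdf 0 s x).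
Proof.
move=> s0; have s20 : s ^+ 2 != 0 by rewrite sqrf_eq0.
have := @stein_normal_pdf _ 0 s s0 (fun x => sin (t * x + th))
  (fun x => t * cos (t * x + th)) (1 + `|t|) _
  (fun x => is_derive_sin_affine x t th) _ _.
move=> /(_ _ _ _)/wrap[].
- move=> x; apply: cvgM; first exact: cvg_cst.
  apply/differentiable_continuous/derivable1_diffP.
  by case: (is_derive_cos_affine x t th).
- move=> x; rewrite subr0; have := sin_max (t * x + th).
  by have := normr_ge0 t; have := normr_ge0 x; nra.
- move=> x; rewrite subr0 normrM; have := cos_max (t * x + th).
  by have := normr_ge0 t; have := sqr_ge0 x; nra.
have -> : \int[mu]_x (t * cos (t * x + th) * normal_pdf 0 s x) =
          t * \int[mu]_x (cos (t * x + th) * normal_pdf 0 s x).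
  under eq_Rintegral do rewrite -mulrA.
  by rewrite RintegralZl//; exact: integrable_cos_normal_pdf.
have -> : \int[mu]_x ((x - 0) / s ^+ 2 * sin (t * x + th) * normal_pdf 0 s x) =
          (s ^+ 2)^-1 * \int[mu]_x (x * sin (t * x + th) * normal_pdf 0 s x).
  rewrite -RintegralZl//; last exact: integrable_sin_normal_pdf.
  by apply: eq_Rintegral => x _; rewrite subr0; ring.
by move=> h; rewrite -mulrA h mulVKf.
Qed.

(** Differentiation under the integral sign produces x sin(t x + th), which
    [stein_sin_normal_pdf] turns back into the integral itself. *)
Lemma is_derive_normal_cos s t th : s != 0 ->
  is_derive t (1:R) (fun t => \int[mu]_x (cos (t * x + th) * normal_pdf 0 s x))
    (- (s ^+ 2 * t * \int[mu]_x (cos (t * x + th) * normal_pdf 0 s x))).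
Proof.
move=> s0; pose f t x := cos (t * x + th) * normal_pdf 0 s x : R.
have dfx u x :
    is_derive u (1:R) (f ^~ x) (- (x * sin (u * x + th) * normal_pdf 0 s x)).
  by rewrite /f; apply: is_derive_eq; rewrite /GRing.scale/=; ring.
have d1f u x : partial1of2 f u x = - (x * sin (u * x + th) * normal_pdf 0 s x).
  by rewrite partial1of2E; case: (dfx u x).
have It : `]t - 1, t + 1[%classic t by rewrite /= in_itv/=; apply/andP; split; lra.
have If u : `]t - 1, t + 1[%classic u -> mu.-integrable setT (EFin \o f u).
  by move=> _; exact: integrable_cos_normal_pdf.
have Df u x : `]t - 1, t + 1[%classic u -> setT x -> derivable (f^~ x) u 1.
  by move=> _ _; case: (dfx u x).
pose G x : R := (1 + x ^+ 2) * normal_pdf 0 s x.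
have G0 x : 0 <= G x by rewrite mulr_ge0 ?normal_pdf_ge0// addr_ge0// sqr_ge0.
have iG : mu.-integrable setT (EFin \o G).
  apply: (@integrable_quadratic_normal_pdf _ 0 s s0 _ 1).
    by apply: measurable_funD => //; exact: measurable_funX.
  by move=> x; rewrite mul1r subr0 ger0_norm// addr_ge0// sqr_ge0.
have fG u x : `]t - 1, t + 1[%classic u -> setT x -> `|partial1of2 f u x| <= G x.
  move=> _ _; rewrite d1f normrN normrM (ger0_norm (normal_pdf_ge0 _ _ _)).
  rewrite ler_wpM2r ?normal_pdf_ge0//.
  rewrite normrM -(real_normK (num_real x)).
  have := sin_max (u * x + th); have := normr_ge0 x.
  have := normr_ge0 (sin (u * x + th)).
  by move: `|x| `|sin _| => a b; have := sqr_ge0 (1 - a); nra.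
apply: DeriveDef.
  exact: (derivable_under_integral measurableT It If Df G0 iG fG).
rewrite -derive1E (differentiation_under_integral measurableT It If Df G0 iG fG).
rewrite -stein_sin_normal_pdf//.
under eq_Rintegral do rewrite d1f -mulN1r.
by rewrite RintegralZl ?mulN1r//; exact: integrable_sin_normal_pdf.
Qed.

(** The left-hand side J satisfies J' = - s^2 t J in the variable t, so
    J(t) exp((s t)^2 / 2) is constant, equal to its value at t = 0. *)
Lemma normal_pdf_charfun s t th : s != 0 ->
  \int[mu]_x (cos (t * x + th) * normal_pdf 0 s x) =
  cos th * expR (- ((s * t) ^+ 2 / 2)).
Proof.
move=> s0; pose J t := \int[mu]_x (cos (t * x + th) * normal_pdf 0 s x).
pose E t : R := J t * expR ((s * t) ^+ 2 / 2).
have dE u : is_derive u (1:R) E 0.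
  have dJ : is_derive u (1:R) J _ := is_derive_normal_cos u th s0.
  rewrite /E; apply: is_derive_eq; rewrite -/(J u) /GRing.scale/=; field.
  by [].
have J0 : J 0 = cos th.
  rewrite /J; under eq_Rintegral do rewrite mul0r add0r.
  rewrite RintegralZl ?Rintegral_normal_pdf ?mulr1//.
  exact: integrable_normal_pdf.
have : E t = E 0 := @is_derive_0_is_cst R E t 0 dE.
rewrite /E mulr0 expr0n mul0r expR0 mulr1 J0 => <-.
by rewrite -/(J t) expRN mulfK// gt_eqF// expR_gt0.
Qed.

Lemma normal_pdf_sym (y s a : R) : s != 0 -> normal_pdf y s a = normal_pdf a s y.
Proof.
by move=> s0; rewrite !normal_pdfE// /normal_fun -(sqrrN (a - y)) opprB.
Qed.

(** A Gaussian density is, up to a constant, the characteristic function of a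
    Gaussian law: this displays it as a mixture of cosines in y. *)
Lemma normal_pdf_fourier (a s y : R) : s != 0 ->
  normal_pdf y s a = normal_peak s *
    \int[mu]_x (cos (x / s * y + - (x / s * a)) * normal_pdf 0 1 x).
Proof.
move=> s0; rewrite normal_pdfE//; congr (_ * _).
transitivity (\int[mu]_x (cos ((y - a) / s * x + 0) * normal_pdf 0 1 x));
  last first.
  by apply: eq_Rintegral => x _; congr (cos _ * _); field.
rewrite normal_pdf_charfun// cos0 mul1r mul1r /normal_fun -mulr_natr.
by congr expR; field.
Qed.

(** The error is at most K E|X - y| for X normal with mean y and standard
    deviation s, and |v| <= (s + v^2 / s) / 2 bounds E|X - y| by s. *)
Lemma normal_pdf_lipschitz_approx (k : R -> R) (K C s y : R) : 0 < s ->
  measurable_fun setT k -> (forall x, `|k x| <= C) ->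
  (forall x z, `|k x - k z| <= K * `|x - z|) ->
  `|k y - \int[mu]_a (k a * normal_pdf y s a)| <= K * s.
Proof.
move=> s0 mk kC kK; have sN0 : s != 0 by rewrite gt_eqF.
have K0 : 0 <= K.
  by have := le_trans (normr_ge0 _) (kK 1 0); rewrite subr0 normr1 mulr1.
have ik : mu.-integrable setT (fun a => (k a * normal_pdf y s a)%:E).
  apply: (@integrable_quadratic_normal_pdf _ y s sN0 _ C) => // a.
  rewrite (le_trans (kC a))// ler_peMr ?lerDl ?sqr_ge0//.
  exact: le_trans (normr_ge0 _) (kC a).
have ip := integrable_normal_pdf y s.
have icp : mu.-integrable setT (fun a => (k y * normal_pdf y s a)%:E).
  by under eq_fun do rewrite EFinM; exact: integrableZl.
have -> : k y - \int[mu]_a (k a * normal_pdf y s a) =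
          \int[mu]_a ((k y - k a) * normal_pdf y s a).
  under [RHS]eq_Rintegral do rewrite mulrBl.
  by rewrite RintegralB// RintegralZl// Rintegral_normal_pdf mulr1.
have id : mu.-integrable setT (fun a => ((k y - k a) * normal_pdf y s a)%:E).
  by under eq_fun do rewrite mulrBl EFinB; exact: integrableB.
apply: le_trans (le_normr_Rintegral measurableT id) _.
have iq : mu.-integrable setT (fun a => ((a - y) ^+ 2 * normal_pdf y s a)%:E).
  apply: (@integrable_quadratic_normal_pdf _ y s sN0 _ 1).
    by apply: measurable_funX; apply: measurable_funB.
  by move=> x; rewrite mul1r ger0_norm ?sqr_ge0// lerDr.
have i1 : mu.-integrable setT (fun a => (K / 2 * s * normal_pdf y s a)%:E).
  by under eq_fun do rewrite EFinM; exact: integrableZl.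
have i2 : mu.-integrable setT
    (fun a => (K / 2 / s * ((a - y) ^+ 2 * normal_pdf y s a))%:E).
  by under eq_fun do rewrite EFinM; exact: integrableZl.
have -> : K * s = \int[mu]_a (K / 2 * s * normal_pdf y s a
                  + K / 2 / s * ((a - y) ^+ 2 * normal_pdf y s a)).
  rewrite RintegralD// !RintegralZl// Rintegral_normal_pdf normal_pdf_variance//.
  by field.
apply: le_Rintegral => //.
- exact: (integrable_norm id).
- by rewrite /comp; under eq_fun do rewrite EFinD; exact: integrableD.
move=> a _; rewrite normrM (ger0_norm (normal_pdf_ge0 _ _ _)).
rewrite [in leRHS]mulrA -mulrDl ler_wpM2r ?normal_pdf_ge0//.
apply: le_trans (kK y a) _; rewrite distrC -(real_normK (num_real (a - y))).
have := normr_ge0 (a - y); move: `|a - y| => v v0.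
rewrite -!mulrA -mulrDr ler_wpM2l//.
rewrite -(ler_pM2l (mulr_gt0 (ltr0Sn R 1) s0)).
have -> : 2 * s * (2^-1 * s + 2^-1 * (s^-1 * v ^+ 2)) = s ^+ 2 + v ^+ 2 by field.
by have := sqr_ge0 (s - v); nra.
Qed.

End Moments.

(** * Expectations under normal laws *)

Section NormalLaw.
Context d (T : measurableType d) (R : realType) (P : probability T R).
Local Notation mu := (@lebesgue_measure R).
Implicit Types (m s : R).

Definition rv_of (X : T -> R) (mX : measurable_fun setT X) : {RV P >-> R} :=
  mfun_Sub (mem_set mX).

(** The density is the Radon-Nikodym derivative of the law almost everywhere,
    because both integrate to the same measure. *)
Lemma integral_normal_prob m s (f : R -> R) :
  (normal_prob m s).-integrable setT (EFin \o f) ->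
  (\int[normal_prob m s]_x (f x)%:E = \int[mu]_x (f x * normal_pdf m s x)%:E)%E.
Proof.
move=> intf; have mf := measurable_int _ intf.
have mfp : measurable_fun setT (fun x : R => (f x * normal_pdf m s x)%:E).
  apply/measurable_EFinP/measurable_funM; first exact/measurable_EFinP.
  exact: measurable_normal_pdf.
have dom := normal_prob_dominates m s.
rewrite -(Radon_Nikodym_change_of_variables dom measurableT intf).

apply: ae_eq_integral => //.
- exact: emeasurable_funM.
- under [X in ae_eq _ _ _ X]eq_fun do rewrite EFinM.
  apply: ae_eqe_mul2l => /=.
  rewrite Radon_NikodymE//=.
  case: cid => /= h [h1 h2 h3].
  apply: integral_ae_eq => //=.
  + by apply/measurable_EFinP; exact: measurable_normal_pdf.
  + by move=> A _ mA; rewrite -h3.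
Qed.

Lemma Rintegral_normal_law m s (X : T -> R) (f : R -> R) :
  measurable_fun setT X -> has_law P X (normal_prob m s) ->
  measurable_fun setT f -> P.-integrable setT (EFin \o (f \o X)) ->
  \int[P]_w f (X w) = \int[mu]_x (f x * normal_pdf m s x).
Proof.
move=> mX lX mf intf; rewrite /Rintegral; congr fine.
have mf' : measurable_fun setT (EFin \o f) by exact/measurable_EFinP.
(* [normal_prob] lives on [measurableTypeR R], which carries the same
   sigma-algebra as R but another display. *)
have mX' : @measurable_fun _ _ T (measurableTypeR R) setT X by [].
pose X' : {RV P >-> measurableTypeR R} :=
  @mfun_Sub _ _ T (measurableTypeR R) X (mem_set mX').
have eqlaw (h : measurableTypeR R -> \bar R) :
    (\int[distribution P X']_x h x = \int[normal_prob m s]_x h x)%E.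
  by apply: eq_measure_integral => A mA _; exact: lX.
transitivity (\int[distribution P X']_x (f x)%:E)%E.
  by rewrite integral_distribution.
rewrite eqlaw integral_normal_prob//.
apply/integrableP; split=> //.
rewrite -eqlaw ge0_integral_distribution//; last exact: measurableT_comp.
by case/integrableP : intf.
Qed.

End NormalLaw.

Section CenteredGaussian.
Context d (T : measurableType d) (R : realType) (P : probability T R).
Local Notation mu := (@lebesgue_measure R).

Lemma Rintegral_dirac_law (m : R) (X : T -> R) (f : R -> R) :
  measurable_fun setT X -> has_law P X \d_m ->
  measurable_fun setT f -> P.-integrable setT (EFin \o (f \o X)) ->
  \int[P]_w f (X w) = f m.
Proof.
move=> mX lX mf intf; rewrite /Rintegral.
have mf' : measurable_fun setT (EFin \o f) by exact/measurable_EFinP.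
pose X' : {RV P >-> R} := mfun_Sub (mem_set mX).
have -> : (\int[P]_w (f (X w))%:E = \int[distribution P X']_x (f x)%:E)%E.
  by rewrite integral_distribution.
rewrite (eq_measure_integral \d_m); last by move=> A mA _; exact: lX.
by rewrite integral_dirac// diracE mem_set// -EFinM /= mul1r.
Qed.

Lemma Rintegral_prob_cst (r : R) : \int[P]_w r = r.
Proof.
transitivity (r * fine (P setT)); first exact: Rintegral_cst.
by rewrite probability_setT mulr1.
Qed.

Lemma Rintegral_indic_event (A : set T) : measurable A ->
  (\int[P]_w \1_A w)%:E = P A.
Proof.
by move=> mA; rewrite /Rintegral integral_indic// setIT fineK// fin_num_measure.
Qed.

Lemma integrable_bounded (f : T -> R) (C : R) : measurable_fun setT f ->
  (forall w, `|f w| <= C) -> P.-integrable setT (EFin \o f).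
Proof.
move=> mf fC; apply: measurable_bounded_integrable => //.
- by rewrite (le_lt_trans (probability_le1 _ _))// ltry.
- exists C; split; first exact: num_real.
  by move=> x Cx w _; exact: le_trans (fC w) (ltW Cx).
Qed.

Lemma measurable_cosD (L : T -> R) (th : R) : measurable_fun setT L ->
  measurable_fun setT (fun w => cos (L w + th)).
Proof.
move=> mL; apply: measurableT_comp; last exact: measurable_funD.
by apply: continuous_measurable_fun; exact: continuous_cos.
Qed.

Lemma integrable_cosD (L : T -> R) (th : R) : measurable_fun setT L ->
  P.-integrable setT (EFin \o (fun w => cos (L w + th))).
Proof.
move=> mL; apply: (@integrable_bounded _ 1); first exact: measurable_cosD.
by move=> w; exact: cos_max.
Qed.

Variables (L : T -> R) (v : R).
Hypotheses (mL : measurable_fun setT L) (gL : gaussian P L)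
  (iL : P.-integrable setT (EFin \o L))
  (iL2 : P.-integrable setT (EFin \o (fun w => L w ^+ 2)))
  (EL : \int[P]_w L w = 0) (EL2 : \int[P]_w (L w ^+ 2) = v).

(** The parameters of a normal law are its mean and standard deviation, so they
    can be read off the first two moments of L. *)
Lemma centered_gaussian_law :
  (exists s, [/\ 0 < s, v = s ^+ 2 & has_law P L (normal_prob 0 s)]) \/
  (v = 0 /\ has_law P L \d_(0:R)).
Proof.
case: gL => [[m [s [s0 lL]]]|[m lL]].
  have sN0 : s != 0 by rewrite gt_eqF.
  have m0 : m = 0.
    have : \int[P]_w (L w - m) = 0.
      rewrite (Rintegral_normal_law (f := fun x => x - m) mL lL).
      - exact: normal_pdf_centered.
      - exact: measurable_funB.
      - rewrite /comp; under eq_fun do rewrite EFinB; apply: integrableB => //.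
        by apply: finite_measure_integrable_cst.
    rewrite RintegralB//; last exact: finite_measure_integrable_cst.
    by rewrite EL Rintegral_prob_cst sub0r => /eqP; rewrite oppr_eq0 => /eqP.
  left; exists s; split=> //; last by rewrite -m0.
  rewrite -EL2 (Rintegral_normal_law (f := fun x => x ^+ 2) mL lL)//.
  rewrite -[RHS](normal_pdf_variance m sN0).
  by apply: eq_Rintegral => x _; rewrite m0 subr0.
right.
have m0 : m = 0 by rewrite -EL (Rintegral_dirac_law (f := id) mL lL).
split; last by rewrite -m0.
rewrite -EL2 (Rintegral_dirac_law (f := fun x => x ^+ 2) mL lL)//.
by rewrite m0 expr0n.
Qed.

Lemma centered_gaussian_charfun (th : R) :
  \int[P]_w cos (L w + th) = cos th * expR (- (v / 2)).
Proof.
have mc : measurable_fun setT (fun x : R => cos (x + th)).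
  have := @measurable_cos_affine R 1 th.
  by apply: eq_measurable_fun => x _; rewrite mul1r.
have ic := integrable_cosD th mL.
case: centered_gaussian_law => [[s [s0 -> lL]]|[-> lL]].
  rewrite (Rintegral_normal_law (f := fun x => cos (x + th)) mL lL)//.
  under eq_Rintegral do rewrite -[X in X + th]mul1r.
  by rewrite normal_pdf_charfun ?mulr1// gt_eqF.
rewrite (Rintegral_dirac_law (f := fun x => cos (x + th)) mL lL)//.
by rewrite add0r mul0r oppr0 expR0 mulr1.
Qed.

Lemma standard_gaussian_law : v = 1 -> has_law P L (normal_prob 0 1).
Proof.
move=> v1; case: centered_gaussian_law => [[s [s0 vs lL]]|[]]; last first.
  by rewrite v1 => /eqP; rewrite oner_eq0.
have /eqP : s ^+ 2 = 1 by rewrite -vs.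
by rewrite sqrf_eq1 => /orP[/eqP<-//|/eqP s1]; move: s0; rewrite s1 ltr0N1.
Qed.

End CenteredGaussian.

(** * Bounded weights orthogonal to all trigonometric functions of a variable *)

Section DominatedSwap.
Context d (T : measurableType d) (R : realType) (P : probability T R).
Local Notation mu := (@lebesgue_measure R).

Lemma lebesgue_integrable_le (f h : R -> R) : measurable_fun setT f ->
  (forall x, `|f x| <= h x) -> mu.-integrable setT (EFin \o h) ->
  mu.-integrable setT (EFin \o f).
Proof.
move=> mf fh; have mf' : measurable_fun setT (EFin \o f) by exact/measurable_EFinP.
apply: le_integrable => //.
by move=> x _ /=; rewrite lee_fin (le_trans (fh x))// ler_norm.
Qed.

Section Swap.
Variables (F : T -> R -> R) (h : R -> R).
Hypotheses (mF : measurable_fun setT (fun z : T * R => F z.1 z.2))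
  (Fh : forall w x, `|F w x| <= h x) (ih : mu.-integrable setT (EFin \o h)).

Let mFw w : measurable_fun setT (F w).
Proof.
have mp : measurable_fun setT (fun x : R => (w, x)) by exact: measurable_pair1.
exact: measurableT_comp mF mp.
Qed.

Let mFx x : measurable_fun setT (F ^~ x).
Proof.
have mp : measurable_fun setT (fun w : T => (w, x)) by exact: measurable_pair2.
exact: measurableT_comp mF mp.
Qed.

Let iw w : mu.-integrable setT (EFin \o F w).
Proof. exact: lebesgue_integrable_le ih. Qed.

Let ix x : P.-integrable setT (EFin \o F ^~ x).
Proof. by apply: (@integrable_bounded _ _ _ P _ (h x)). Qed.

Let f (z : T * measurableTypeR R) : \bar R := (F z.1 z.2)%:E.

Let intf : (P \x mu)%E.-integrable setT f.
Proof.
have mf : measurable_fun setT f by apply/measurable_EFinP; exact: mF.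
apply/integrable21ltyP => //.
have h0 x : 0 <= h x by exact: le_trans (normr_ge0 _) (Fh point x).
apply: (@le_lt_trans _ _ (\int[mu]_x (h x)%:E)%E).
  apply: ge0_le_integral => //.
  - by move=> x _; exact: integral_ge0.
  - apply: (@measurable_fun_fubini_tonelli_G _ _ T (measurableTypeR R) R P
      (abse \o f)) => //=.
    exact: measurableT_comp.
  - exact: (measurable_int mu ih).
  move=> x _; rewrite -[leRHS]mule1 -(probability_setT P) -integral_cst//.
  apply: ge0_le_integral => //.
  - have mEF : measurable_fun setT (EFin \o F ^~ x) by exact/measurable_EFinP.
    exact: measurableT_comp mEF.
  - by move=> w _; rewrite lee_fin.
have /integrableP[_] := ih.
by under eq_integral do rewrite /= ger0_norm//.
Qed.

Let fineF w : (\int[mu]_x F w x)%:E = (\int[mu]_x (F w x)%:E)%E.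
Proof. by rewrite fineK//; exact: (integrable_fin_num _ (iw w)). Qed.

Lemma integrable_Rintegral_dominated :
  P.-integrable setT (EFin \o (fun w => \int[mu]_x F w x)).
Proof.
have -> : EFin \o (fun w => \int[mu]_x F w x) = fubini_F mu f.
  by apply/funext => w /=; rewrite fineF.
exact: integrable_fubini_F.
Qed.

Lemma Rintegral_swap :
  \int[P]_w (\int[mu]_x F w x) = \int[mu]_x (\int[P]_w F w x).
Proof.
have := Fubini intf; rewrite /f/= {1 3}/Rintegral => E; congr fine.
transitivity (\int[P]_x \int[mu]_y (F x y)%:E)%E.
  by apply: eq_integral => w _; rewrite fineF.
rewrite E; apply: eq_integral => x _; rewrite fineK//.
exact: (integrable_fin_num _ (ix x)).
Qed.

End Swap.

End DominatedSwap.

Section WeightSmoothing.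
Context d (T : measurableType d) (R : realType) (P : probability T R).
Local Notation mu := (@lebesgue_measure R).
Variables (W Y : T -> R) (M : R).
Hypotheses (mW : measurable_fun setT W) (mY : measurable_fun setT Y)
  (WM : forall w, `|W w| <= M)
  (WY : forall t th, \int[P]_w (W w * cos (t * Y w + th)) = 0).

Let M0 : 0 <= M.
Proof. exact: le_trans (normr_ge0 _) (WM point). Qed.

(** Exchange the expectation with the mixture of [normal_pdf_fourier]. *)
Lemma weight_annihilates_normal_pdf (a s : R) : s != 0 ->
  \int[P]_w (W w * normal_pdf (Y w) s a) = 0.
Proof.
move=> s0.
pose F w x : R := W w * (cos (x / s * Y w + - (x / s * a)) * normal_pdf 0 1 x).
have mp : measurable_fun setT (normal_pdf 0 1 : R -> R).
  exact: measurable_normal_pdf.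
have mZ : measurable_fun setT (fun z : T * R => z.2 / s).
  by apply: measurable_funM.
have mF : measurable_fun setT (fun z : T * R => F z.1 z.2).
  apply: measurable_funM; first exact: measurableT_comp.
  apply: measurable_funM; last exact: measurableT_comp.
  apply: (@measurableT_comp _ _ _ _ _ _ (@cos R)).
    by apply: continuous_measurable_fun; exact: continuous_cos.
  apply: measurable_funD.
    by apply: measurable_funM => //; exact: measurableT_comp.
  by apply: measurableT_comp => //; exact: measurable_funM.
have Fb w x : `|F w x| <= M * normal_pdf 0 1 x.
  rewrite !normrM (ger0_norm (normal_pdf_ge0 _ _ _)).
  rewrite ler_pM// ?mulr_ge0 ?normal_pdf_ge0//.
  by rewrite ler_piMl ?normal_pdf_ge0// cos_max.
have ip : mu.-integrable setT (EFin \o (fun x => M * normal_pdf 0 1 x)).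
  rewrite /comp; under eq_fun do rewrite EFinM.
  by apply: integrableZl => //; exact: integrable_normal_pdf.
have Fx x : \int[P]_w F w x = 0.
  rewrite /F; under eq_Rintegral do rewrite mulrA.
  rewrite RintegralZr ?WY ?mul0r//.
  apply: (@integrable_bounded _ _ _ _ _ M).
    apply: measurable_funM => //; apply: measurable_cosD.
    by apply: measurable_funM.
  by move=> w; rewrite normrM (le_trans _ (WM w))// ler_piMr// cos_max.
have Fw w : \int[mu]_x F w x = (normal_peak s)^-1 * (W w * normal_pdf (Y w) s a).
  rewrite RintegralZl//; last first.
    apply: (@integrable_quadratic_normal_pdf _ 0 1 (oner_neq0 _) _ 1).
      apply: (@measurableT_comp _ _ _ _ _ _ (@cos R)).
        by apply: continuous_measurable_fun; exact: continuous_cos.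
      by apply: measurable_funD; [|apply: measurableT_comp => //];
        apply: measurable_funM => //; apply: measurable_funM.
    by move=> x; rewrite mul1r (le_trans (cos_max _))// lerDl sqr_ge0.
  by rewrite normal_pdf_fourier// mulrCA mulKf// gt_eqF// normal_peak_gt0.
have := Rintegral_swap P mF Fb ip.
under [RHS]eq_Rintegral do rewrite Fx.
rewrite Rintegral_cst// mul0r; under eq_Rintegral do rewrite Fw.
rewrite RintegralZl//.
  by move/eqP; rewrite mulf_eq0 invr_eq0 gt_eqF/= ?normal_peak_gt0// => /eqP.
under eq_fun do rewrite normal_pdf_sym//.
apply: (@integrable_bounded _ _ _ _ _ (M * normal_peak s)).
  apply: measurable_funM => //; apply: measurableT_comp => //.
  exact: measurable_normal_pdf.
move=> w; rewrite normrM (ger0_norm (normal_pdf_ge0 _ _ _)).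
by rewrite ler_pM ?normal_pdf_ge0// normal_pdf_ub.
Qed.


(** The convolution of k with a Gaussian density of standard deviation s is a
    mixture of Gaussian densities, hence annihilated by W, and it differs from k
    by at most K s; integrability of k licenses the exchange of integrals. *)
Lemma weight_annihilates_lipschitz (k : R -> R) (K C : R) :
  measurable_fun setT k -> (forall x, `|k x| <= C) ->
  (forall x z, `|k x - k z| <= K * `|x - z|) ->
  mu.-integrable setT (EFin \o k) ->
  \int[P]_w (W w * k (Y w)) = 0.
Proof.
move=> mk kC kK ik.
have K0 : 0 <= K.
  by have := le_trans (normr_ge0 _) (kK 1 0); rewrite subr0 normr1 mulr1.
have C0 : 0 <= C := le_trans (normr_ge0 _) (kC 0).
have iWk : P.-integrable setT (EFin \o (fun w => W w * k (Y w))).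
  apply: (@integrable_bounded _ _ _ _ _ (M * C)).
    by apply: measurable_funM => //; exact: measurableT_comp.
  by move=> w; rewrite normrM ler_pM.
suff bnd s : 0 < s -> `|\int[P]_w (W w * k (Y w))| <= M * K * s.
  apply/eqP; rewrite -normr_le0; apply/ler_addgt0Pr => e e0; rewrite add0r.
  have MK0 : 0 < M * K + 1 by rewrite ltr_wpDl// mulr_ge0.
  apply: le_trans (bnd (e / (M * K + 1)) _) _; first by rewrite divr_gt0.
  by rewrite mulrCA ler_piMr ?(ltW e0)// ler_pdivrMr// mul1r lerDl.
move=> s0; have sN0 : s != 0 by rewrite gt_eqF.
pose F w a : R := W w * (k a * normal_pdf (Y w) s a).
have mpd : measurable_fun setT (fun z : T * R => normal_pdf (Y z.1) s z.2).
  have -> : (fun z : T * R => normal_pdf (Y z.1) s z.2) =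
            (fun z => normal_pdf 0 s (z.2 - Y z.1)).
    by apply/funext => z; rewrite !normal_pdfE// /normal_fun subr0.
  apply: measurableT_comp; first exact: measurable_normal_pdf.
  by apply: measurable_funB => //; exact: measurableT_comp.
have mF : measurable_fun setT (fun z : T * R => F z.1 z.2).
  apply: measurable_funM; first exact: measurableT_comp.
  by apply: measurable_funM => //; exact: measurableT_comp.
have Fb w a : `|F w a| <= M * normal_peak s * `|k a|.
  rewrite !normrM (ger0_norm (normal_pdf_ge0 _ _ _)) -mulrA (mulrC _ `|k a|).
  by rewrite ler_pM ?mulr_ge0 ?normal_pdf_ge0// ler_wpM2l// normal_pdf_ub.
have ih : mu.-integrable setT (EFin \o (fun a => M * normal_peak s * `|k a|)).
  rewrite /comp; under eq_fun do rewrite EFinM.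
  by apply: integrableZl => //; exact: integrable_norm ik.
have Fa a : \int[P]_w F w a = 0.
  rewrite /F; under eq_Rintegral do rewrite mulrCA.
  rewrite RintegralZl ?weight_annihilates_normal_pdf ?mulr0//.
  under eq_fun do rewrite normal_pdf_sym//.
  apply: (@integrable_bounded _ _ _ _ _ (M * normal_peak s)).
    apply: measurable_funM => //; apply: measurableT_comp => //.
    exact: measurable_normal_pdf.
  move=> w; rewrite normrM (ger0_norm (normal_pdf_ge0 _ _ _)).
  by rewrite ler_pM ?normal_pdf_ge0// normal_pdf_ub.
have := Rintegral_swap P mF Fb ih.
under [RHS]eq_Rintegral do rewrite Fa.
rewrite Rintegral_cst// mul0r => E.
have iF := integrable_Rintegral_dominated P mF Fb ih.
rewrite -[X in `|X|]subr0 -E -RintegralB//.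
apply: le_trans (le_normr_Rintegral measurableT _) _.
  by rewrite /comp; under eq_fun do rewrite EFinB; exact: integrableB.
rewrite -[leRHS](Rintegral_prob_cst P).
apply: le_Rintegral => //.
- apply: integrable_norm.
  by rewrite /comp; under eq_fun do rewrite EFinB; exact: integrableB.
- exact: finite_measure_integrable_cst.
move=> w _; rewrite RintegralZl//; last first.
  apply: (@integrable_quadratic_normal_pdf _ (Y w) s sN0 _ C) => // a.
  by rewrite (le_trans (kC a))// ler_peMr ?lerDl ?sqr_ge0.
rewrite -mulrBr normrM -mulrA ler_pM//.
exact: normal_pdf_lipschitz_approx mk kC kK.
Qed.

End WeightSmoothing.

Section Trapezoid.
Context {R : realType}.
Local Notation mu := (@lebesgue_measure R).
Variables (u : R) (n : nat).

(** Vanishing outside [u, n] makes it integrable, the bounded slopes make it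
    Lipschitz, and as n grows it tends to the indicator of ]u, +oo[. *)
Definition trapezoid (a : R) : R :=
  Num.min 1 (n%:R * Num.max 0 (Num.min (a - u) (n%:R - a))).

Lemma trapezoid_ge0 a : 0 <= trapezoid a.
Proof. by rewrite /trapezoid le_min ler01 mulr_ge0// le_max lexx. Qed.

Lemma trapezoid_le1 a : trapezoid a <= 1.
Proof. by rewrite /trapezoid ge_min lexx. Qed.

Lemma trapezoid_norm_le1 a : `|trapezoid a| <= 1.
Proof. by rewrite ger0_norm ?trapezoid_ge0 ?trapezoid_le1. Qed.

Lemma trapezoid_lipschitz a b : `|trapezoid a - trapezoid b| <= n%:R * `|a - b|.
Proof.
rewrite /trapezoid.
pose h z : R := Num.max 0 (Num.min (z - u) (n%:R - z)).
have h_lip : `|h a - h b| <= `|a - b|.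
  have := ler_norm (a - b); have := ler_norm (b - a); rewrite (distrC b a).
  move: `|a - b| => c h1 h2; rewrite ler_norml /h /Order.max /Order.min.
  by repeat case: ifPn; rewrite -?leNgt => *; apply/andP; split; lra.
apply: (@le_trans _ _ (n%:R * `|h a - h b|)); last by rewrite ler_wpM2l.
rewrite -/(h a) -/(h b).
move: (h a) (h b) => x y.
rewrite -[n%:R in leRHS](@ger0_norm R)// -normrM mulrBr.
move: (n%:R * x) (n%:R * y) => {}x {}y.
have := ler_norm (x - y); have := ler_norm (y - x); rewrite (distrC y x).
move: `|x - y| => c h1 h2; rewrite ler_norml /Order.min.
by repeat case: ifPn; rewrite -?leNgt => *; apply/andP; split; lra.
Qed.

Lemma measurable_trapezoid : measurable_fun setT trapezoid.
Proof.
apply: measurable_minr => //; apply: measurable_funM => //.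
apply: measurable_maxr => //; apply: measurable_minr.
  exact: measurable_funB.
exact: measurable_funB.
Qed.

Lemma integrable_trapezoid : mu.-integrable setT (EFin \o trapezoid).
Proof.
apply: (lebesgue_integrable_le (h := \1_`[u, n%:R])); last first.
- exact: integrable_indic_itv.
- move=> a; rewrite ger0_norm ?trapezoid_ge0// indicE.
  have [_|] := boolP (a \in `[u, n%:R]%classic); first exact: trapezoid_le1.
  rewrite notin_setE/= in_itv/= => /negP; rewrite negb_and -!ltNge => h.
  have m0 : Num.min (a - u) (n%:R - a) <= 0.
    rewrite ge_min; apply/orP.
    by case/orP: h => h; [left|right]; rewrite subr_le0 ltW.
  by rewrite /trapezoid (max_idPl m0) mulr0 ge_min lexx orbT.
- exact: measurable_trapezoid.
Qed.

End Trapezoid.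

Lemma trapezoid_cvg (R : realType) (u a : R) :
  trapezoid u n a @[n --> \oo] --> (\1_(`]u, +oo[%classic) a : R).
Proof.
rewrite indicE; apply: cvg_near_cst.
have [ua|au] := ltP u a; last first.
  apply: nearW => n; rewrite memNset/=; last by rewrite in_itv/= andbT ltNge au.
  have m0 : Num.min (a - u) (n%:R - a) <= 0 by rewrite ge_min subr_le0 au.
  by rewrite /trapezoid (max_idPl m0) mulr0; apply/min_idPr.
have d0 : 0 < a - u by rewrite subr_gt0.
near=> n; rewrite mem_set/=; last by rewrite in_itv/= andbT.
have n1 : (a - u)^-1 <= n%:R by near: n; exact: nbhs_infty_ger.
have n2 : a + 1 <= n%:R by near: n; exact: nbhs_infty_ger.
have n3 : 1 <= n%:R :> R by near: n; exact: nbhs_infty_ger.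
apply/min_idPl.
have h1 : 1 <= n%:R * (a - u) by rewrite -ler_pdivrMr// mul1r.
have h2 : 1 <= n%:R * (n%:R - a) by nra.
apply: (@le_trans _ _ (n%:R * Num.min (a - u) (n%:R - a))).
  by rewrite /Order.min; case: ifP.
by rewrite ler_wpM2l// le_max lexx orbT.
Unshelve. all: by end_near. Qed.

Section WeightIndicators.
Context d (T : measurableType d) (R : realType) (P : probability T R).
Local Notation mu := (@lebesgue_measure R).

Lemma Rintegral_bounded_cvg (f_ : nat -> T -> R) (f : T -> R) (C : R) :
  (forall n, measurable_fun setT (f_ n)) -> measurable_fun setT f ->
  (forall n w, `|f_ n w| <= C) ->
  (forall w, f_ n w @[n --> \oo] --> f w) ->
  \int[P]_w f_ n w @[n --> \oo] --> \int[P]_w f w.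
Proof.
move=> mf_ mf fC ff.
have if_ n : P.-integrable setT (EFin \o f_ n).
  exact: integrable_bounded (mf_ n) (fC n).
have fb w : `|f w| <= C.
  have h : `|f_ n w| @[n --> \oo] --> `|f w| by apply: cvg_norm; exact: ff.
  rewrite -(cvg_lim _ h)//.
  by apply: limr_le; [exact: cvgP h|exact: nearW].
have jf : P.-integrable setT (EFin \o f) by exact: integrable_bounded mf fb.
apply: fine_cvg; rewrite -/(Rintegral _ _ _) fineK ?integrable_fin_num//.
apply: (@dominated_cvg _ _ _ P setT measurableT
    (fun n w => (f_ n w)%:E) (EFin \o f) (fun=> C%:E)) => //.
- by move=> n; apply/measurable_EFinP; exact: mf_.
- by move=> w _; apply: cvg_EFin; [exact: nearW|exact: ff].
- exact: finite_measure_integrable_cst.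
- by move=> n w _; rewrite lee_fin.
Qed.

Variables (W Y : T -> R) (M : R).
Hypotheses (mW : measurable_fun setT W) (mY : measurable_fun setT Y)
  (WM : forall w, `|W w| <= M)
  (WY : forall t th, \int[P]_w (W w * cos (t * Y w + th)) = 0).

Let mWY (B : set R) : measurable B ->
  measurable_fun setT (fun w => W w * \1_B (Y w)).
Proof. by move=> mB; apply: measurable_funM => //; apply: measurableT_comp. Qed.

Let bWY (B : set R) w : `|W w * \1_B (Y w)| <= M.
Proof.
rewrite normrM (le_trans _ (WM w))// ler_piMr// indicE.
by case: (_ \in _); rewrite ?normr1 ?normr0.
Qed.

Let iWY (B : set R) : measurable B ->
  P.-integrable setT (EFin \o (fun w => W w * \1_B (Y w))).
Proof. by move=> mB; exact: integrable_bounded (mWY mB) (bWY B). Qed.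

Lemma weight_annihilates_ray (u : R) :
  \int[P]_w (W w * \1_(`]u, +oo[%classic) (Y w)) = 0.
Proof.
have : \int[P]_w (W w * trapezoid u n (Y w)) @[n --> \oo] -->
       \int[P]_w (W w * \1_(`]u, +oo[%classic) (Y w)).
  apply: (@Rintegral_bounded_cvg _ _ M).
  - move=> n; apply: measurable_funM => //.
    by apply: measurableT_comp => //; exact: measurable_trapezoid.
  - exact: mWY.
  - move=> n w; rewrite normrM (le_trans _ (WM w))// ler_piMr//.
    exact: trapezoid_norm_le1.
  - by move=> w; apply: cvgMr; exact: trapezoid_cvg.
under eq_fun do rewrite (weight_annihilates_lipschitz mW mY WM WY
  (measurable_trapezoid u _)
  (trapezoid_norm_le1 u _) (trapezoid_lipschitz u _) (integrable_trapezoid u _)).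
by move=> h; exact: (cvg_unique _ h (cvg_cst 0)).
Qed.

(** The open half-lines are stable under intersection and generate the Borel
    sets, and the sets B in question form a Dynkin class. *)
Lemma weight_annihilates_indic (B : set R) : measurable B ->
  \int[P]_w (W w * \1_B (Y w)) = 0.
Proof.
move=> mB.
have WT : \int[P]_w W w = 0.
  rewrite -(WY 0 0); apply: eq_Rintegral => w _.
  by rewrite mul0r addr0 cos0 mulr1.
pose G := [set A : set R | exists x, A = `]x, +oo[%classic].
have GE : @measurable _ R = <<s G >> by exact: RGenOInfty.measurableE.
apply: (@dynkin_induction _ R G (fun B => \int[P]_w (W w * \1_B (Y w)) = 0)) => //.
- move=> _ _ [x ->] [y ->]; exists (Num.max x y).
  by apply/seteqP; split=> z /=; rewrite !in_itv/= !andbT gt_max => /andP.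
- by rewrite -WT; apply: eq_Rintegral => w _; rewrite indicT mulr1.
- by move=> _ [x ->]; exact: weight_annihilates_ray.
- move=> S mS WS; rewrite -[RHS](subrr 0) -{1}WT -WS -RintegralB//; last exact: iWY.
    apply: eq_Rintegral => w _; rewrite !indicE in_setC.
    by case: (_ \in _); rewrite ?mulr1 ?mulr0 ?subrr ?subr0.
  exact: integrable_bounded mW WM.
- move=> F mF tF WF.
  pose U n := \big[setU/set0]_(i < n) F i.
  have mU n : measurable (U n) by exact: bigsetU_measurable.
  have WU n : \int[P]_w (W w * \1_(U n) (Y w)) = 0.
    elim: n => [|n IH].
      rewrite /U big_ord0; under eq_Rintegral do rewrite indic0 mulr0.
      by rewrite Rintegral_cst// mul0r.
    rewrite -[RHS](addr0 0) -[X in X + _]IH -[X in _ + X](WF n).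
    rewrite -RintegralD//; [|exact: iWY..].
    apply: eq_Rintegral => w _; rewrite -mulrDr; congr (_ * _).
    have disj : ~ (U n (Y w) /\ F n (Y w)).
      rewrite /U -bigcup_mkord => -[[i /= ni Fi] Fn].
      have := tF i n Logic.I Logic.I (ex_intro _ (Y w) (conj Fi Fn)).
      by move=> ein; rewrite ein ltnn in ni.
    rewrite /U big_ord_recr/= -/(U n) !indicE in_setU.
    have [/set_mem Uw|_] := boolP (Y w \in U n); last by rewrite add0r.
    have [/set_mem Fw|_] := boolP (Y w \in F n); last by rewrite addr0.
    by case: disj.
  have : \int[P]_w (W w * \1_(U n) (Y w)) @[n --> \oo] -->
       \int[P]_w (W w * \1_(\bigcup_k F k) (Y w)).
    apply: (@Rintegral_bounded_cvg _ _ M) => //.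
    - by move=> n; exact: mWY.
    - by apply: mWY; exact: bigcup_measurable.
    - move=> w; apply: cvgMr.
      rewrite !indicE; apply: cvg_near_cst.
      have [[k _ Fk]|nF] := pselect ((\bigcup_k F k) (Y w)).
        near=> n; rewrite indicE !mem_set//; first by exists k.
        rewrite /U -bigcup_mkord; exists k => //=.
        by near: n; exact: nbhs_infty_gt.
      apply: nearW => n; rewrite indicE !memNset//.
      by rewrite /U -bigcup_mkord => -[k _ Fk]; apply: nF; exists k.
  under eq_fun do rewrite WU.
  by move=> h; exact: (cvg_unique _ h (cvg_cst 0)).
- by rewrite -GE.
Unshelve. all: by end_near. Qed.

End WeightIndicators.

(** * Independence from the characteristic function of linear combinations *)

Lemma cos_mul_cos (R : realType) (a b : R) :
  cos a * cos b = 2^-1 * (cos (a + b) + cos (a - b)).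
Proof. by rewrite cosD cosB; field. Qed.

Section Independence.
Context d (T : measurableType d) (R : realType) (P : probability T R).
Variables (I : finType) (Y : I -> T -> R).
Hypothesis mY : forall i, measurable_fun setT (Y i).
Hypothesis charY : forall (c : I -> R) (th : R),
  \int[P]_w cos (\sum_i c i * Y i w + th) =
  cos th * expR (- ((\sum_i c i ^+ 2) / 2)).

Let ev (s : seq I) (B : I -> set R) w : R := \prod_(i <- s) \1_(B i) (Y i w).

Let ev01 s B w : 0 <= ev s B w <= 1.
Proof.
rewrite /ev; elim/big_ind: _ => [|x y|i _]; first by rewrite ler01 lexx.
  by move=> /andP[x0 x1] /andP[y0 y1]; rewrite mulr_ge0//= mulr_ile1.
by rewrite indicE; case: (_ \in _); rewrite ?ler01 ?lexx.
Qed.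

Let mev s B : (forall i, measurable (B i)) -> measurable_fun setT (ev s B).
Proof.
move=> mB; rewrite /ev; elim: s => [|i s IH].
  by under eq_fun do rewrite big_nil; exact: measurable_cst.
under eq_fun do rewrite big_cons; apply: measurable_funM => //.
by apply: measurableT_comp => //; exact: measurable_indic.
Qed.

Let mlin (c : I -> R) : measurable_fun setT (fun w => \sum_i c i * Y i w).
Proof. by apply: measurable_sum => i; exact: measurable_funM. Qed.

Let mevc s B c th : (forall i, measurable (B i)) ->
  measurable_fun setT (fun w => ev s B w * cos (\sum_i c i * Y i w + th)).
Proof.
by move=> mB; apply: measurable_funM; [exact: mev|exact: measurable_cosD].
Qed.

Let bevc s B c th w : `|ev s B w * cos (\sum_i c i * Y i w + th)| <= 1.
Proof.
have /andP[e0 e1] := ev01 s B w.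
by rewrite normrM ger0_norm// mulr_ile1// cos_max.
Qed.

Let ievc s B c th : (forall i, measurable (B i)) ->
  P.-integrable setT (EFin \o (fun w => ev s B w * cos (\sum_i c i * Y i w + th))).
Proof. by move=> mB; exact: integrable_bounded (mevc _ _ _ mB) (bevc s B c th). Qed.

(** The coordinates in s have been replaced by indicators, the others still
    enter through a cosine.  To move one more coordinate j into s, the product
    formula for cosines and the induction hypothesis at c + t e_j and c - t e_j
    show that W, the integrand for the previous s, satisfies
    E[W cos(t Y_j + eta)] = E[W] E[cos(t Y_j + eta)] for all t and eta; hence
    W - E[W] is orthogonal to every indicator of Y_j. *)
Lemma mixed_charfun (s : seq I) (B : I -> set R) :
  uniq s -> (forall i, measurable (B i)) ->
  forall (c : I -> R) (th : R), (forall i, i \in s -> c i = 0) ->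
  \int[P]_w (ev s B w * cos (\sum_i c i * Y i w + th)) =
  \prod_(i <- s) (\int[P]_w \1_(B i) (Y i w)) *
    (cos th * expR (- ((\sum_i c i ^+ 2) / 2))).
Proof.
move=> us mB; elim: s us => [_|j s IH /= /andP[js us]] c th c0.
  rewrite big_nil mul1r -charY; apply: eq_Rintegral => w _.
  by rewrite /ev big_nil mul1r.
have cj0 : c j = 0 by apply: c0; rewrite mem_head.
have cs0 i : i \in s -> c i = 0 by move=> si; apply: c0; rewrite inE si orbT.
pose W w := ev s B w * cos (\sum_i c i * Y i w + th).
pose K := \int[P]_w W w.
pose ct t i := c i + (if i == j then t else 0).
have ct0 t i : i \in s -> ct t i = 0.
  by move=> si; rewrite /ct cs0// add0r; case: eqP => // ij; rewrite -ij si in js.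
have ctY t w : \sum_i ct t i * Y i w = \sum_i c i * Y i w + t * Y j w.
  rewrite /ct; under eq_bigr do rewrite mulrDl.
  rewrite big_split/=; congr (_ + _); rewrite (bigD1 j)//= eqxx big1 ?addr0//.
  by move=> i /negbTE->; rewrite mul0r.
have ct2 t : \sum_i ct t i ^+ 2 = \sum_i c i ^+ 2 + t ^+ 2.
  rewrite (bigD1 j)//= [in RHS](bigD1 j)//= {1}/ct eqxx cj0 add0r expr0n add0r.
  rewrite addrC; congr (_ + _); apply: eq_bigr => i /negbTE ij.
  by rewrite /ct ij addr0.
have KE : K = \prod_(i <- s) (\int[P]_w \1_(B i) (Y i w)) *
    (cos th * expR (- ((\sum_i c i ^+ 2) / 2))) by exact: IH.
have Wt t eta : \int[P]_w (W w * cos (t * Y j w + eta)) =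
    K * (cos eta * expR (- (t ^+ 2 / 2))).
  transitivity (\int[P]_w (2^-1 *
      (ev s B w * cos (\sum_i ct t i * Y i w + (th + eta)) +
       ev s B w * cos (\sum_i ct (- t) i * Y i w + (th - eta))))).
    apply: eq_Rintegral => w _; rewrite /W -mulrA cos_mul_cos -mulrDr mulrCA.
    congr (_ * (_ * (cos _ + cos _))); rewrite ctY; ring.
  rewrite RintegralZl//; last first.
    rewrite /comp; under eq_fun do rewrite EFinD.
    by apply: integrableD => //; exact: ievc.
  rewrite RintegralD//; [|exact: ievc..].
  rewrite !IH//; [|exact: ct0..].
  rewrite !ct2 sqrrN KE mulrDl opprD expRD cosB cosD; field.
  by [].
have charj t eta :
    \int[P]_w cos (t * Y j w + eta) = cos eta * expR (- (t ^+ 2 / 2)).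
  pose c' i : R := if i == j then t else 0.
  have := charY c' eta.
  have -> : \sum_i c' i ^+ 2 = t ^+ 2.
    rewrite (bigD1 j)//= /c' eqxx big1 ?addr0// => i /negbTE->.
    by rewrite expr0n.
  move=> <-; apply: eq_Rintegral => w _; congr (cos (_ + _)).
  by rewrite (bigD1 j)//= /c' eqxx big1 ?addr0// => i /negbTE->; rewrite mul0r.
have mW : measurable_fun setT W by exact: mevc.
have iW : P.-integrable setT (EFin \o W) by exact: ievc.
have mWK : measurable_fun setT (fun w => W w - K) by exact: measurable_funB.
have bWK w : `|W w - K| <= 1 + `|K|.
  by rewrite (le_trans (ler_normB _ _))// lerD2r bevc.
have WK t eta : \int[P]_w ((W w - K) * cos (t * Y j w + eta)) = 0.
  have mc : measurable_fun setT (fun w => cos (t * Y j w + eta)).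
    by apply: measurable_cosD; exact: measurable_funM.
  under eq_Rintegral do rewrite mulrBl.
  rewrite RintegralB//.
  - rewrite RintegralZl//; first by rewrite Wt charj subrr.
    by apply: (@integrable_bounded _ _ _ P _ 1) => // w; exact: cos_max.
  - apply: (@integrable_bounded _ _ _ P _ 1); first exact: measurable_funM.
    by move=> w; rewrite normrM mulr_ile1// ?bevc// cos_max.
  - apply: (@integrable_bounded _ _ _ P _ `|K|); first exact: measurable_funM.
    by move=> w; rewrite normrM ler_piMr// cos_max.
have := weight_annihilates_indic mWK (mY j) bWK WK (mB j).
have m1 : measurable_fun setT (fun w => \1_(B j) (Y j w) : R).
  by apply: measurableT_comp => //; exact: measurable_indic.
have b1 w : `|\1_(B j) (Y j w) : R| <= 1.
  by rewrite indicE; case: (_ \in _); rewrite ?normr1 ?normr0.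
under eq_Rintegral do rewrite mulrBl.
rewrite RintegralB//; last 2 first.
- apply: (@integrable_bounded _ _ _ P _ 1); first exact: measurable_funM.
  by move=> w; rewrite normrM mulr_ile1// bevc.
- apply: (@integrable_bounded _ _ _ P _ `|K|); first exact: measurable_funM.
  by move=> w; rewrite normrM ler_piMr.
rewrite RintegralZl//; last exact: integrable_bounded m1 b1.
move/eqP; rewrite subr_eq0 => /eqP E.
rewrite big_cons -mulrA -KE mulrC -E.
by apply: eq_Rintegral => w _; rewrite /W /ev big_cons; ring.
Qed.

Theorem charfun_independent : independent P Y.
Proof.
move=> s B us mB.
have mA i : measurable (Y i @^-1` B i).
  by rewrite -[X in measurable X]setTI; exact: mY.
have := mixed_charfun us mB (c := fun=> 0) 0 (fun _ _ => erefl).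
rewrite cos0 mul1r [X in expR X](_ : _ = 0); last first.
  by rewrite big1 ?mul0r ?oppr0// => i _; rewrite expr0n.
rewrite expR0 mulr1.
pose S (r : seq I) := [set w | forall i, i \in r -> B i (Y i w)].
have SE j r : S (j :: r) = (Y j @^-1` B j) `&` S r.
  apply/seteqP; split=> w.
    by move=> Sw; split=> [|i ir]; apply: Sw; rewrite inE ?eqxx// ir orbT.
  by move=> [Bj Sr] i; rewrite inE => /orP[/eqP->//|]; exact: Sr.
have S0 : S [::] = setT by apply/seteqP; split.
have mS r : measurable (S r).
  by elim: r => [|j r IH]; [rewrite S0|rewrite SE; exact: measurableI].
have evS r w : ev r B w = \1_(S r) w.
  rewrite /ev; elim: r => [|j r IH]; first by rewrite big_nil S0 indicT.
  by rewrite big_cons IH SE indicI.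
have -> : \int[P]_w (ev s B w * cos (\sum_i 0 * Y i w + 0)) =
    \int[P]_w \1_(S s) w.
  apply: eq_Rintegral => w _; rewrite evS big1 ?addr0 ?cos0 ?mulr1// => i _.
  by rewrite mul0r.
move=> E; rewrite -(Rintegral_indic_event P (mS s)) E -prodEFin.
by apply: eq_bigr => i _; rewrite -Rintegral_indic_event.
Qed.

End Independence.

(** * Characters of the cube *)

Section CubeFourier.
Context (R : realType) (N : nat).
Implicit Types (A B : {set 'I_N}) (x y z : cube N).
Local Notation sgn := (@sgn_prod R N).

Lemma add_mod2K x : involutive (add_mod2 x).
Proof. by move=> y; apply: eq_from_tnth => j; rewrite !tnth_mktuple addKb. Qed.

Lemma sgn_prod_add A x y : sgn A (add_mod2 x y) = sgn A x * sgn A y.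
Proof.
rewrite /sgn_prod -big_split/=; apply: eq_bigr => j _.
by rewrite tnth_mktuple signr_addb.
Qed.

Lemma sgn_prod_sqr A x : sgn A x * sgn A x = 1.
Proof.
rewrite /sgn_prod -big_split/= big1// => j _.
by rewrite -signr_addb addbb.
Qed.

Lemma sgn_prod_norm A x : `|sgn A x| = 1.
Proof. by rewrite /sgn_prod normr_prod big1// => j _; rewrite normr_sign. Qed.

Lemma sgn_prod0 x : sgn finset.set0 x = 1.
Proof. by rewrite /sgn_prod big_set0. Qed.

(** The sum over A of chi_A(x + y) factors as the product over the coordinates i
    of 1 + (-1)^((x + y)_i), which vanishes as soon as x and y differ. *)
Lemma sum_sgn_prod_sets x y :
  \sum_(A : {set 'I_N}) sgn A x * sgn A y = (2 ^ N)%:R *+ (x == y).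
Proof.
have [->|xy] := eqVneq x y.
  under eq_bigr do rewrite sgn_prod_sqr.
  by rewrite sumr_const -cardsT -powersetT card_powerset cardsT card_ord.
have [j xyj] : exists j, tnth x j != tnth y j.
  apply/existsP; rewrite -negb_forall; apply: contra xy => /forallP e.
  by apply/eqP/eq_from_tnth => j; exact/eqP/e.
under eq_bigr do rewrite -sgn_prod_add.
rewrite (_ : \sum_A _ = \prod_(i < N) ((-1) ^+ tnth (add_mod2 x y) i + 1)).
  rewrite (bigD1 j)//= tnth_mktuple; move: xyj.
  by case: (tnth x j) (tnth y j) => -[]//= _; rewrite expr1 addNr mul0r.
rewrite bigA_distr; apply: eq_big => [A|A _]; first by rewrite inE.
by rewrite /sgn_prod big_mkcond.
Qed.

(** If j belongs to exactly one of A and B, flipping the entry j of x changes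
    the sign of every term, so the sum is its own opposite. *)
Lemma sum_sgn_prod_cube A B :
  \sum_(x : cube N) sgn A x * sgn B x = (2 ^ N)%:R *+ (A == B).
Proof.
have [->|AB] := eqVneq A B.
  under eq_bigr do rewrite sgn_prod_sqr.
  by rewrite sumr_const card_tuple card_bool.
have [j ABj] : exists j, (j \in A) != (j \in B).
  apply/existsP; rewrite -negb_forall; apply: contra AB => /forallP e.
  by apply/eqP/setP => j; exact/eqP/e.
pose e : cube N := [tuple i == j | i < N].
have sgne (C : {set 'I_N}) : sgn C e = (-1) ^+ (j \in C).
  rewrite /sgn_prod; have [jC|jC] := boolP (j \in C).
    rewrite (bigD1 j)//= tnth_mktuple eqxx big1 ?mulr1// => i /andP[_ /negbTE ij].
    by rewrite tnth_mktuple ij.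
  rewrite big1// => i iC; rewrite tnth_mktuple; case: eqP => // ij.
  by rewrite ij (negbTE jC) in iC.
set S := \sum_x _.
have : S = - S.
  rewrite {1}/S (reindex_inj (inv_inj (add_mod2K e)))/= /S -sumrN.
  apply: eq_bigr => x _; rewrite !sgn_prod_add !sgne mulrACA -signr_addb.
  by case: (j \in A) (j \in B) ABj => -[]//= _; rewrite expr1 mulN1r.
by move/eqP; rewrite -addr_eq0 -mulr2n mulrn_eq0/= => /eqP.
Qed.

End CubeFourier.

(** * The Green function of the walk *)

Section FiniteProbability.
Context d (T : measurableType d) (R : realType) (Q : probability T R) (N : nat).

(** The sigma-algebra of the cube is generated by the coordinates, hence
    contains the singletons. *)
Lemma measurable_cube (B : set (cube N)) : measurable B.
Proof.
have m1 (z : cube N) : measurable [set z].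
  have -> : [set z] = \bigcap_(j in [set: 'I_N])
      ((fun x : cube N => tnth x j) @^-1` [set tnth z j]).
    apply/seteqP; split=> x /=; first by move=> -> j _.
    by move=> h; apply: eq_from_tnth => j; exact: h.
  apply: fin_bigcap_measurable => // j _.
  by rewrite -[X in measurable X]setTI; exact: measurable_tnth.
have -> : B = \bigcup_(z in B) [set z].
  by apply/seteqP; split=> x; [move=> Bx; exists x|move=> [z Bz ->]].
by apply: fin_bigcup_measurable.
Qed.

Lemma measurable_cube_preimage (X : {RV Q >-> cube N}) (B : set (cube N)) :
  measurable (X @^-1` B).
Proof.
rewrite -[X in measurable X]setTI.
by apply: measurable_funP => //; exact: measurable_cube.
Qed.

Lemma Rintegral_fsum (I : finType) (f : I -> T -> R) :
  (forall i, Q.-integrable setT (EFin \o f i)) ->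
  \int[Q]_w (\sum_i f i w) = \sum_i \int[Q]_w f i w.
Proof.
move=> intf; rewrite /Rintegral.
under eq_integral do rewrite -sumEFin.
rewrite (integral_sum _ (f := fun i => EFin \o f i))//.
by rewrite -sum_fine// => i _; exact: (integrable_fin_num _ (intf i)).
Qed.

Lemma Rintegral_indic_cube (X : {RV Q >-> cube N}) (h : cube N -> R) (E : set T) :
  measurable E ->
  \int[Q]_w (\1_E w * h (X w)) =
  \sum_(z : cube N) h z * fine (Q (E `&` X @^-1` [set z])).
Proof.
move=> mE; have mEz z : measurable (E `&` X @^-1` [set z]).
  by apply: measurableI => //; exact: measurable_cube_preimage.
have iEz z : Q.-integrable setT (EFin \o \1_(E `&` X @^-1` [set z])).
  exact: integrable_indic.
transitivity (\int[Q]_w (\sum_(z : cube N) h z * \1_(E `&` X @^-1` [set z]) w)).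
  apply: eq_Rintegral => w _; rewrite (bigD1 (X w))//= big1 ?addr0.
    rewrite indicI/= mulrC; congr (_ * _).
    by rewrite [X in _ * X]indicE mem_set ?mulr1.
  move=> z zX; rewrite indicI/= [X in _ * (_ * X)]indicE memNset ?mulr0//=.
  by move=> Xz; rewrite Xz eqxx in zX.
rewrite Rintegral_fsum.
  apply: eq_bigr => z _; rewrite RintegralZl//; congr (_ * _).
  by rewrite -[LHS]/(fine (_)%:E) Rintegral_indic_event.
move=> z; rewrite /comp; under eq_fun do rewrite EFinM.
exact: (integrableZl _ _ (iEz z)).
Qed.

Lemma prob_partition (X : {RV Q >-> cube N}) (E : set T) : measurable E ->
  fine (Q E) = \sum_(z : cube N) fine (Q (E `&` X @^-1` [set z])).
Proof.
move=> mE; rewrite -Rintegral_indic_event//=.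
rewrite (_ : \int[Q]_w _ = \int[Q]_w (\1_E w * 1)).
  rewrite (Rintegral_indic_cube X (fun=> 1) mE).
  by apply: eq_bigr => z _; rewrite mul1r.
by apply: eq_Rintegral => w _; rewrite mulr1.
Qed.

Lemma rhoE (Z : {RV Q >-> cube N}) (A : {set 'I_N}) :
  rho Z A = \sum_(z : cube N) sgn_prod R A z * fine (Q (Z @^-1` [set z])).
Proof.
rewrite /rho unlock -/(Rintegral _ _ _).
transitivity (\int[Q]_w (\1_setT w * sgn_prod R A (Z w))).
  by apply: eq_Rintegral => w _; rewrite indicT mul1r.
rewrite Rintegral_indic_cube//.
by apply: eq_bigr => z _; rewrite setTI.
Qed.

Lemma pmf_total (X : {RV Q >-> cube N}) :
  \sum_(z : cube N) fine (Q (X @^-1` [set z])) = 1.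
Proof.
have := prob_partition X (@measurableT _ T).
rewrite probability_setT/= => ->.
by apply: eq_bigr => z _; rewrite setTI.
Qed.

Lemma rho_norm_le1 (Z : {RV Q >-> cube N}) (A : {set 'I_N}) : `|rho Z A| <= 1.
Proof.
rewrite rhoE; apply: le_trans (ler_norm_sum _ _ _) _.
under eq_bigr do rewrite normrM sgn_prod_norm mul1r ger0_norm ?fine_ge0//.
by rewrite pmf_total.
Qed.

Lemma rho0 (Z : {RV Q >-> cube N}) : rho Z finset.set0 = 1.
Proof.
rewrite rhoE -(pmf_total Z).
by apply: eq_bigr => z _; rewrite sgn_prod0 mul1r.
Qed.

Lemma pmf_fourier (Z : {RV Q >-> cube N}) (z : cube N) :
  fine (Q (Z @^-1` [set z])) =
  (2 ^ N)%:R^-1 * \sum_(A : {set 'I_N}) rho Z A * sgn_prod R A z.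
Proof.
under eq_bigr do rewrite rhoE mulr_suml.
rewrite exchange_big/=.
under eq_bigr => y _.
  under eq_bigr do rewrite mulrAC.
  rewrite -mulr_suml sum_sgn_prod_sets.
  over.
rewrite (bigD1 z)//= eqxx mulr1n big1 ?addr0 ?mulKf//.
by move=> y /negbTE yz; rewrite yz mulr0n mul0r.
Qed.

End FiniteProbability.

Section Walk.
Context d (T : measurableType d) (R : realType) (Q : probability T R) (N : nat).
Variables (Z : {RV Q >-> cube N}) (Zs X : nat -> {RV Q >-> cube N}).
Hypothesis hX : random_walk Z Zs X.
Local Notation sgn := (@sgn_prod R N).

(** Decompose according to X_t: on the event X_t = z, a move to y means
    Z_t = z + y, and Z_t is independent of the past. *)
Lemma joint_step (t : nat) (x y : cube N) :
  fine (Q (X t.+1 @^-1` [set y] `&` X 0%N @^-1` [set x])) =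
  \sum_(z : cube N) fine (Q (X t @^-1` [set z] `&` X 0%N @^-1` [set x])) *
    fine (Q (Z @^-1` [set add_mod2 z y])).
Proof.
rewrite (prob_partition (X t)); last first.
  by apply: measurableI; exact: measurable_cube_preimage.
apply: eq_bigr => z _.
pose past w := [tuple X (i : nat) w | i < t.+1].
pose B := [set p : t.+1.-tuple (cube N) | tnth p ord_max = z /\ tnth p ord0 = x].
have mB : measurable B.
  have -> : B = (fun p => tnth p ord_max) @^-1` [set z] `&`
                (fun p => tnth p ord0) @^-1` [set x] by [].
  by apply: measurableI; rewrite -[X in measurable X]setTI;
    apply: measurable_tnth => //; exact: measurable_cube.
have pastE : past @^-1` B = X t @^-1` [set z] `&` X 0%N @^-1` [set x].
  by apply/seteqP; split=> w; rewrite /preimage/= /B/past/= !tnth_mktuple.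
have -> : X t.+1 @^-1` [set y] `&` X 0%N @^-1` [set x] `&` X t @^-1` [set z] =
    Zs t @^-1` [set add_mod2 z y] `&` past @^-1` B.
  rewrite pastE; apply/seteqP; split=> w /=; rewrite (walk_step hX).
    by move=> [[<- <-] <-]; rewrite add_mod2K.
  by move=> [-> [-> ->]]; rewrite add_mod2K.
rewrite (walk_past hX)//; last exact: measurable_cube.
rewrite (walk_copies hX)//; last exact: measurable_cube.
rewrite pastE fineM ?fin_num_measure//; last 2 first.
- exact: measurable_cube_preimage.
- by apply: measurableI; exact: measurable_cube_preimage.
by rewrite mulrC.
Qed.

(** Each step convolves with the law of Z, which multiplies the coefficient of
    chi_A by rho_A. *)
Lemma joint_fourier (t : nat) (x y : cube N) :
  fine (Q (X t @^-1` [set y] `&` X 0%N @^-1` [set x])) =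
  fine (Q (X 0%N @^-1` [set x])) *
  ((2 ^ N)%:R^-1 * \sum_(A : {set 'I_N}) rho Z A ^+ t * (sgn A x * sgn A y)).
Proof.
have N0 : (2 ^ N)%:R != 0 :> R by rewrite pnatr_eq0 expn_eq0.
elim: t y => [|t IH] y.
  under eq_bigr do rewrite expr0 mul1r.
  rewrite sum_sgn_prod_sets; have [->|xy] := eqVneq x y.
    by rewrite mulr1n mulVf// mulr1 setIid.
  rewrite mulr0n !mulr0 (_ : _ `&` _ = set0) ?measure0//.
  by apply/seteqP; split=> // w /= [yw xw]; move: xy; rewrite -yw -xw eqxx.
rewrite joint_step.
under eq_bigr do rewrite IH (pmf_fourier Z).
transitivity (fine (Q (X 0%N @^-1` [set x])) * ((2 ^ N)%:R^-1 * (2 ^ N)%:R^-1 *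
    \sum_(A : {set 'I_N}) \sum_(B : {set 'I_N})
      (rho Z A ^+ t * sgn A x) * (rho Z B * sgn B y) *
      \sum_(z : cube N) sgn A z * sgn B z)).
  transitivity (\sum_(z : cube N) fine (Q (X 0%N @^-1` [set x])) *
    ((2 ^ N)%:R^-1 * (2 ^ N)%:R^-1 *
    \sum_(A : {set 'I_N}) \sum_(B : {set 'I_N})
      (rho Z A ^+ t * sgn A x) * (rho Z B * sgn B y) * (sgn A z * sgn B z))).
    apply: eq_bigr => z _; rewrite -!mulrA; congr (_ * (_ * _)).
    rewrite mulrCA; congr (_ * _); rewrite mulr_suml; apply: eq_bigr => A _.
    rewrite mulr_sumr; apply: eq_bigr => B _; rewrite sgn_prod_add; ring.
  rewrite -!mulr_sumr exchange_big/=; congr (_ * (_ * _)); apply: eq_bigr => A _.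
  rewrite exchange_big/=; apply: eq_bigr => B _.
  by rewrite mulr_sumr.
congr (_ * _); rewrite -mulrA; congr (_ * _).
rewrite mulr_sumr; apply: eq_bigr => A _.
rewrite (bigD1 A)//= sum_sgn_prod_cube eqxx big1 ?addr0.
  by rewrite exprSr mulr1n; field.
by move=> B; rewrite eq_sym => /negbTE BA; rewrite sum_sgn_prod_cube BA mulr0.
Qed.

Hypothesis hX0 : forall x : cube N, (0 < Q (X 0%N @^-1` [set x]))%E.

Lemma transition_fourier (t : nat) (x y : cube N) :
  transition X t x y =
  (2 ^ N)%:R^-1 * \sum_(A : {set 'I_N}) rho Z A ^+ t * (sgn A x * sgn A y).
Proof.
rewrite /transition joint_fourier mulrAC mulfV ?mul1r// gt_eqF//.
rewrite fine_gt0// hX0 ltey_eq fin_num_measure//.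
exact: measurable_cube_preimage.
Qed.

(** The series is a finite combination of geometric series with ratios
    alpha rho_A, of modulus at most alpha. *)
Lemma green_fourier (alpha : R) (x y : cube N) : 0 < alpha -> alpha < 1 ->
  green X alpha x y =
  (2 ^ N)%:R^-1 * \sum_(A : {set 'I_N}) (sgn A x * sgn A y) / (1 - alpha * rho Z A).
Proof.
move=> a0 a1; apply/cvg_lim => //.
have -> : series (fun t => alpha ^+ t * transition X t x y) =
    (fun n => (2 ^ N)%:R^-1 * \sum_(A : {set 'I_N})
      series (geometric (sgn A x * sgn A y) (alpha * rho Z A)) n).
  apply/funext => n; rewrite /series/= exchange_big/= mulr_sumr.
  apply: eq_bigr => t _; rewrite transition_fourier mulrCA; congr (_ * _).
  by rewrite mulr_sumr; apply: eq_bigr => A _; rewrite exprMn; ring.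
apply: cvgMr; apply: cvg_big => [|A _]; first exact: add_continuous.
apply: cvg_geometric_series; rewrite normrM gtr0_norm//.
by apply: le_lt_trans a1; rewrite ler_piMr ?(ltW a0)// rho_norm_le1.
Qed.

End Walk.

(** * Exchangeable increments *)

Section Exchangeable.
Context d (T : measurableType d) (R : realType) (Q : probability T R) (N : nat).
Variable Z : {RV Q >-> cube N}.
Hypothesis exZ : exchangeable Z.

Lemma rho_perm (s : 'S_N) (A : {set 'I_N}) : rho Z (s @: A) = rho Z A.
Proof.
pose f (x : cube N) : cube N := [tuple tnth x (s j) | j < N].
have finj : injective f.
  move=> x y fxy; apply: eq_from_tnth => j.
  have := congr1 (fun v : cube N => tnth v ((s^-1)%g j)) fxy.
  by rewrite /= !tnth_mktuple permKV.
rewrite !rhoE [RHS](reindex_inj finj)/=; apply: eq_bigr => z _; congr (_ * _).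
  rewrite /sgn_prod big_imset/=; last by move=> i j _ _; exact: perm_inj.
  by apply: eq_bigr => j _; rewrite tnth_mktuple.
rewrite -(exZ s (measurable_cube [set f z])); congr (fine (Q _)).
by apply/seteqP; split=> w /=; [move=> ->|exact: finj].
Qed.

(** Transpositions exchanging a point of A \ B with a point of B \ A lead from A
    to B when their cardinals agree. *)
Lemma rho_card (A B : {set 'I_N}) : #|A| = #|B| -> rho Z A = rho Z B.
Proof.
have [n] := ubnP #|A :\: B|; elim: n A => // n IH A An AB.
have [AB0|[a]] := set_0Vmem (A :\: B).
  have sAB : A \subset B by rewrite -finset.setD_eq0 AB0.
  by congr rho; apply/eqP; rewrite eqEcard sAB AB leqnn.
rewrite inE => /andP[aB aA].
have [b bBA] : exists b, b \in B :\: A.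
  apply/set0Pn; rewrite -cards_eq0 cardsD finset.setIC -AB -cardsD.
  by apply/negP; rewrite cards_eq0 => /eqP/setP/(_ a); rewrite !inE aB aA.
move: bBA; rewrite inE => /andP[bA bB].
rewrite -(rho_perm (tperm a b) A).
have imE : tperm a b @: A = b |: (A :\ a).
  apply/setP => i; rewrite -[i in LHS](tpermK a b) mem_imset; last exact: perm_inj.
  rewrite !inE; case: tpermP => [->|->|/eqP ia /eqP ib].
  - rewrite (negbTE bA) eqxx andFb orbF.
    by apply/esym/eqP => ab; rewrite -ab aA in bA.
  - by rewrite eqxx aA.
  - by rewrite (negbTE ib) ia.
apply: IH; last by rewrite card_imset//; exact: perm_inj.
rewrite imE -ltnS; apply: leq_trans An; rewrite ltnS.
apply: (@leq_ltn_trans #|(A :\: B) :\ a|).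
  apply: subset_leq_card; apply/fintype.subsetP => i; rewrite !inE.
  by case: eqP => [->|_]/=; [rewrite bB|move=> /andP[-> /andP[-> ->]]].
by rewrite [X in (_ < X)%N](cardsD1 a) inE aB aA ltnS.
Qed.

End Exchangeable.

Lemma sum_by_card (R : realType) (N : nat) (x : cube N) (f : nat -> R)
    (h : {set 'I_N} -> R) :
  \sum_(A : {set 'I_N} | A != finset.set0) f #|A| * sgn_prod R A x * h A =
  \sum_(1 <= k < N.+1) f k * spin k x finset.setT h.
Proof.
rewrite /spin; under [RHS]eq_bigr do rewrite mulr_sumr.
rewrite (exchange_big_dep predT)//= big_mkcond/=; apply: eq_bigr => A _.
under eq_bigl do rewrite finset.subsetT eq_sym/=.
rewrite big_nat1_eq card_gt0 ltnS -[N in (_ <= N)%N]card_ord max_card andbT.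
by case: ifP => // _; rewrite mulrA.
Qed.

(** * Diagonalisation of the field *)

Section Decomposition.
Context (R : realType) (N : nat) (alpha : R).
Hypotheses (a0 : 0 < alpha) (a1 : alpha < 1).
Context (dT : measure_display) (T : measurableType dT) (Q : probability T R).
Variable Z : {RV Q >-> cube N}.
Context (dO : measure_display) (Omega : measurableType dO)
  (P : probability Omega R).
Variable g : cube N -> {RV P >-> R}.
Hypothesis hgauss : gaussian_field P (fun x => g x : Omega -> R).
Hypothesis hmean : forall x, ('E_P[g x] = 0)%E.
Local Notation sgn := (@sgn_prod R N).
Hypothesis hcov : forall x y, covariance P (g x) (g y) =
  ((1 - alpha) * ((2 ^ N)%:R^-1 *
    \sum_(A : {set 'I_N}) (sgn A x * sgn A y) / (1 - alpha * rho Z A)))%:E.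

(** The inverse of the eigenvalue (1 - alpha) / (1 - alpha rho_A) of the
    covariance matrix along the character of A ([precisionE]). *)
Definition precision (A : {set 'I_N}) : R :=
  1 + alpha / (1 - alpha) * (1 - rho Z A).

Let rho_le1 A : rho Z A <= 1.
Proof. exact: le_trans (ler_norm _) (rho_norm_le1 Z A). Qed.

Lemma precision_gt0 A : 0 < precision A.
Proof.
by rewrite ltr_wpDr// mulr_ge0 ?subr_ge0// divr_ge0 ?(ltW a0)// subr_ge0 ltW.
Qed.

Lemma precisionE A : precision A = (1 - alpha * rho Z A) / (1 - alpha).
Proof. by rewrite /precision; field; rewrite subr_eq0 gt_eqF. Qed.

Lemma precision0 : precision finset.set0 = 1.
Proof. by rewrite /precision rho0 subrr mulr0 addr0. Qed.

Let mean_field x : \int[P]_w g x w = 0.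
Proof. by have := hmean x; rewrite unlock => /(congr1 fine). Qed.

Let covE x y : (\int[P]_w (g x w * g y w)%:E)%E =
  ((1 - alpha) * ((2 ^ N)%:R^-1 *
    \sum_(A : {set 'I_N}) (sgn A x * sgn A y) / (1 - alpha * rho Z A)))%:E.
Proof.
rewrite -hcov unlock !hmean/= unlock; apply: eq_integral => w _.
by rewrite -[in LHS](subr0 (g x w)) -[in LHS](subr0 (g y w)).
Qed.

(* The covariances at x = y being finite, the field is square integrable. *)
Let integrable_mul x y : P.-integrable setT (EFin \o (fun w => g x w * g y w)).
Proof.
have mg z : measurable_fun setT (g z) by exact: measurable_funP.
have isq z : P.-integrable setT (EFin \o (fun w => g z w * g z w)).
  apply/integrableP; split; first by apply/measurable_EFinP; exact: measurable_funM.
  rewrite (eq_integral (fun w => (g z w * g z w)%:E)) ?covE ?ltry// => w _ /=.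
  by rewrite ger0_norm// -expr2 sqr_ge0.
apply: (@le_integrable _ _ _ P _ measurableT _
    (fun w => (g x w * g x w)%:E + (g y w * g y w)%:E)%E).
- by apply/measurable_EFinP; exact: measurable_funM.
- move=> w _; rewrite -EFinD lee_fin normrM.
  apply: le_trans (ler_norm _); move: (g x w) (g y w) => u v.
  rewrite -!expr2 -(real_normK (num_real u)) -(real_normK (num_real v)).
  have := normr_ge0 u; have := normr_ge0 v; have := sqr_ge0 (`|u| - `|v|).
  by move: `|u| `|v| => {}u {}v; nra.
- exact: integrableD (isq x) (isq y).
Qed.

Let integrable_field x : P.-integrable setT (EFin \o g x).
Proof.
have mg : measurable_fun setT (g x) by exact: measurable_funP.
apply: (@le_integrable _ _ _ P _ measurableT _
    (fun w => (g x w * g x w)%:E + 1%:E)%E).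
- exact/measurable_EFinP.
- move=> w _; rewrite -EFinD lee_fin.
  apply: le_trans (ler_norm _); move: (g x w) => u.
  rewrite -expr2 -(real_normK (num_real u)).
  have := normr_ge0 u; have := sqr_ge0 (`|u| - 1).
  by move: `|u| => {}u; nra.
- apply: integrableD => //; first exact: integrable_mul.
  exact: finite_measure_integrable_cst.
Qed.

Let N0 : (2 ^ N)%:R != 0 :> R. Proof. by rewrite pnatr_eq0 expn_eq0. Qed.

Let r : R := 2 `^ (N%:R / 2).

Let r0 : r != 0. Proof. by rewrite gt_eqF// powR_gt0. Qed.

Let r2 : r * r = (2 ^ N)%:R.
Proof.
rewrite -powRD; last by rewrite pnatr_eq0 implybT.
rewrite (_ : N%:R / 2 + N%:R / 2 = N%:R); last by field.
by rewrite powR_mulrn// natrX.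
Qed.

(** The coefficient of the field along chi_A / 2^(N/2), divided by its standard
    deviation. *)
Definition fourier_mode (A : {set 'I_N}) (w : Omega) : R :=
  Num.sqrt (precision A) / r * \sum_(x : cube N) sgn A x * g x w.

Lemma measurable_fourier_mode A : measurable_fun setT (fourier_mode A).
Proof.
apply: measurable_funM => //; apply: measurable_sum => x.
by apply: measurable_funM => //; exact: measurable_funP.
Qed.

Lemma fourier_mode_synthesis x w :
  g x w = r^-1 * \sum_(A : {set 'I_N})
    (Num.sqrt (precision A))^-1 * sgn A x * fourier_mode A w.
Proof.
have sN0 A : Num.sqrt (precision A) != 0.
  by rewrite gt_eqF// sqrtr_gt0 precision_gt0.
transitivity ((r * r)^-1 * \sum_(y : cube N)
    (\sum_(A : {set 'I_N}) sgn A x * sgn A y) * g y w).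
  rewrite (bigD1 x)//= [X in _ + X]big1 ?addr0; last first.
    by move=> y; rewrite eq_sym => /negbTE xy; rewrite sum_sgn_prod_sets xy mul0r.
  by rewrite sum_sgn_prod_sets eqxx mulr1n r2 mulKf.
rewrite invfM -mulrA; congr (_ * _).
under eq_bigr do rewrite mulr_suml.
rewrite exchange_big/= mulr_sumr; apply: eq_bigr => A _.
rewrite /fourier_mode (_ : _ * (_ / r * _) =
    r^-1 * (sgn A x * \sum_x0 sgn A x0 * g x0 w)).
  by congr (_ * _); rewrite mulr_sumr; apply: eq_bigr => y _; rewrite mulrA.
by field; rewrite r0 sN0.
Qed.

Section Combination.
Variable c : {set 'I_N} -> R.

(* An arbitrary linear combination of the modes is one of the field, with
   coefficients b. *)
Let L w := \sum_(A : {set 'I_N}) c A * fourier_mode A w.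
Let b x : R := \sum_(A : {set 'I_N}) c A * (Num.sqrt (precision A) / r) * sgn A x.

Let LE w : L w = \sum_(x : cube N) b x * g x w.
Proof.
rewrite /L /b; under [RHS]eq_bigr do rewrite mulr_suml.
rewrite exchange_big/=; apply: eq_bigr => A _.
by rewrite /fourier_mode mulrA mulr_sumr; apply: eq_bigr => x _; rewrite !mulrA.
Qed.

Let mL : measurable_fun setT L.
Proof.
apply: measurable_sum => A; apply: measurable_funM => //.
exact: measurable_fourier_mode.
Qed.

Let gL : gaussian P L.
Proof.
by rewrite (_ : L = fun w => \sum_(x : cube N) b x * g x w)//; exact/funext.
Qed.

Let ibg x : P.-integrable setT (EFin \o (fun w => b x * g x w)).
Proof.
rewrite /comp; under eq_fun do rewrite EFinM.
exact: (integrableZl measurableT (b x) (integrable_field x)).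
Qed.

Let ibgg x y : P.-integrable setT (EFin \o (fun w => b x * b y * (g x w * g y w))).
Proof.
rewrite /comp; under eq_fun do rewrite EFinM.
exact: (integrableZl measurableT (b x * b y) (integrable_mul x y)).
Qed.

Let L2E w : L w ^+ 2 =
  \sum_(x : cube N) \sum_(y : cube N) b x * b y * (g x w * g y w).
Proof.
rewrite LE expr2 mulr_suml; apply: eq_bigr => x _.
by rewrite mulr_sumr; apply: eq_bigr => y _; rewrite mulrACA.
Qed.

Let isum x : P.-integrable setT
  (EFin \o (fun w => \sum_(y : cube N) b x * b y * (g x w * g y w))).
Proof.
rewrite /comp; under eq_fun do rewrite -sumEFin.
by apply: integrable_sum => // y _; exact: ibgg.
Qed.

Let iL : P.-integrable setT (EFin \o L).
Proof.
rewrite /comp; under eq_fun do rewrite LE -sumEFin.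
by apply: integrable_sum => // y _; exact: ibg.
Qed.

Let iL2 : P.-integrable setT (EFin \o (fun w => L w ^+ 2)).
Proof.
rewrite /comp; under eq_fun do rewrite L2E -sumEFin.
by apply: integrable_sum => // x _; exact: isum.
Qed.

Let EL : \int[P]_w L w = 0.
Proof.
under eq_Rintegral do rewrite LE.
rewrite Rintegral_fsum// big1// => x _.
by rewrite RintegralZl ?mean_field ?mulr0.
Qed.

(* The covariance matrix is diagonal in the characters, and the coefficient of
   b along chi_A is proportional to c A by orthogonality. *)
Let EL2 : \int[P]_w (L w ^+ 2) = \sum_(A : {set 'I_N}) c A ^+ 2.
Proof.
under eq_Rintegral do rewrite L2E.
rewrite Rintegral_fsum//.
have sgnb A : \sum_(x : cube N) b x * sgn A x = c A * Num.sqrt (precision A) * r.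
  rewrite /b; under eq_bigr do rewrite mulr_suml.
  rewrite exchange_big/= (bigD1 A)//= [X in _ + X]big1 ?addr0; last first.
    move=> B /negbTE BA; under eq_bigr do rewrite -mulrA.
    by rewrite -mulr_sumr sum_sgn_prod_cube BA mulr0.
  under eq_bigr do rewrite -mulrA.
  by rewrite -mulr_sumr sum_sgn_prod_cube eqxx mulr1n -r2; field.
transitivity (\sum_(A : {set 'I_N})
    (1 - alpha) * (2 ^ N)%:R^-1 / (1 - alpha * rho Z A) *
    (\sum_(x : cube N) b x * sgn A x) * (\sum_(y : cube N) b y * sgn A y)).
  transitivity (\sum_(x : cube N) \sum_(y : cube N) \sum_(A : {set 'I_N})
      (1 - alpha) * (2 ^ N)%:R^-1 / (1 - alpha * rho Z A) *
        (b x * sgn A x) * (b y * sgn A y)).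
    apply: eq_bigr => x _; rewrite Rintegral_fsum//.
    apply: eq_bigr => y _; rewrite RintegralZl// /Rintegral covE/=.
    move: (b x) (b y) => u v; rewrite !mulr_sumr; apply: eq_bigr => A _.
    by move: (2 ^ N)%:R^-1 (1 - alpha * rho Z A)^-1 => p q; ring.
  under eq_bigr do rewrite exchange_big/=.
  rewrite exchange_big/=; apply: eq_bigr => A _.
  rewrite -[RHS]mulrA mulr_suml mulr_sumr; apply: eq_bigr => x _.
  by rewrite !mulr_sumr; apply: eq_bigr => y _; rewrite !mulrA.
apply: eq_bigr => A _; rewrite !sgnb.
have dN0 : 1 - alpha * rho Z A != 0.
  rewrite subr_eq0 eq_sym lt_eqF// (le_lt_trans _ a1)//.
  by rewrite ler_piMr// ltW.
have aN0 : 1 - alpha != 0 by rewrite subr_eq0 gt_eqF.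
have e2 : Num.sqrt (precision A) ^+ 2 = (1 - alpha * rho Z A) / (1 - alpha).
  by rewrite sqr_sqrtr -?precisionE// ltW// precision_gt0.
rewrite -r2.
move: (Num.sqrt (precision A)) e2 r r0 => e e2 q q0.
transitivity (c A ^+ 2 * ((1 - alpha) / (1 - alpha * rho Z A) * e ^+ 2)).
  by field; rewrite ?q0 ?dN0.
by rewrite e2; field; rewrite dN0 aN0.
Qed.

Lemma fourier_mode_charfun (th : R) :
  \int[P]_w cos (\sum_(A : {set 'I_N}) c A * fourier_mode A w + th) =
  cos th * expR (- ((\sum_(A : {set 'I_N}) c A ^+ 2) / 2)).
Proof. exact: (centered_gaussian_charfun mL gL iL iL2 EL EL2). Qed.

Lemma fourier_mode_standard : \sum_(A : {set 'I_N}) c A ^+ 2 = 1 ->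
  has_law P L (normal_prob 0 1).
Proof. exact: (standard_gaussian_law mL gL iL iL2 EL EL2). Qed.

End Combination.

Lemma fourier_mode_law A : has_law P (fourier_mode A) (normal_prob 0 1).
Proof.
pose c B : R := (B == A)%:R.
have -> : fourier_mode A = fun w => \sum_(B : {set 'I_N}) c B * fourier_mode B w.
  apply/funext => w; rewrite (bigD1 A)//= /c eqxx mul1r big1 ?addr0//.
  move=> B /negbTE->.
  by rewrite mul0r.
apply: fourier_mode_standard; rewrite (bigD1 A)//= /c eqxx expr1n big1 ?addr0//.
by move=> B /negbTE->; rewrite expr0n.
Qed.

Lemma fourier_mode_independent : independent P fourier_mode.
Proof. exact: charfun_independent measurable_fourier_mode fourier_mode_charfun. Qed.

End Decomposition.

Theorem proposition2 (R : realType) (N : nat) (hN : (0 < N)%N)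
    (alpha : R) (halpha0 : 0 < alpha) (halpha1 : alpha < 1)
    (dT : measure_display) (T : measurableType dT) (Q : probability T R)
    (Z : {RV Q >-> cube N}) (Zs X : nat -> {RV Q >-> cube N})
    (hX : random_walk Z Zs X)
    (hX0 : forall x : cube N, (0 < Q (X 0%N @^-1` [set x]))%E)
    (dO : measure_display) (Omega : measurableType dO)
    (P : probability Omega R)
    (g : cube N -> {RV P >-> R})
    (hgauss : gaussian_field P (fun x => g x : Omega -> R))
    (hmean : forall x, ('E_P[g x] = 0)%E)
    (hcov : forall x y,
      covariance P (g x) (g y) = ((1 - alpha) * green X alpha x y)%:E) :
  exists gA : {set 'I_N} -> {RV P >-> R},
    [/\ independent P (fun A => gA A : Omega -> R),
        forall A, has_law P (gA A) (normal_prob 0 1),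
        forall (x : cube N) (w : Omega),
          g x w = (2 `^ (N%:R / 2))^-1 *
            (gA finset.set0 w +
             \sum_(A : {set 'I_N} | A != finset.set0)
               (Num.sqrt (1 + alpha / (1 - alpha) * (1 - rho Z A)))^-1 *
               sgn_prod R A x * gA A w)
      & exchangeable Z ->
        exists rhok : nat -> R,
          (forall A : {set 'I_N}, rho Z A = rhok #|A|) /\
          forall (x : cube N) (w : Omega),
            g x w = (2 `^ (N%:R / 2))^-1 *
              (gA finset.set0 w +
               \sum_(1 <= k < N.+1)
                 (Num.sqrt (1 + alpha / (1 - alpha) * (1 - rhok k)))^-1 *
                 spin k x finset.setT (fun A => gA A w))].
Proof.
have hc x y : covariance P (g x) (g y) = ((1 - alpha) * ((2 ^ N)%:R^-1 *
    \sum_(A : {set 'I_N})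
      (sgn_prod R A x * sgn_prod R A y) / (1 - alpha * rho Z A)))%:E.
  by rewrite hcov (green_fourier hX hX0).
exists (fun A => rv_of P (measurable_fourier_mode alpha Z g A)); split.
- exact: fourier_mode_independent.
- exact: fourier_mode_law.
- move=> x w /=.
  rewrite [LHS](fourier_mode_synthesis halpha0 halpha1 Z g x w).
  rewrite (bigD1 finset.set0)//= precision0.
  by rewrite sqrtr1 invr1 sgn_prod0 !mul1r.
- move=> exZ.
  (* Any set of cardinal k represents the common value; there is none for k > N. *)
  pose rhok k := if [pick A : {set 'I_N} | #|A| == k] is Some A then rho Z A else 0.
  have rhokE A : rho Z A = rhok #|A|.
    rewrite /rhok; case: pickP => [B /eqP BA|/(_ A)]; last by rewrite eqxx.
    exact: rho_card.
  exists rhok; split=> // x w /=.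
  rewrite [LHS](fourier_mode_synthesis halpha0 halpha1 Z g x w).
  rewrite (bigD1 finset.set0)//= precision0.
  rewrite sqrtr1 invr1 sgn_prod0 !mul1r -sum_by_card; congr (_ * (_ + _)).
  by apply: eq_bigr => A _; rewrite -rhokE.
Qed.
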